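(* Let $\pi$ be a slant Riemannian map with slant angle $\theta$ from a Riemannian manifold $(P,g_P)$ to a Kähler manifold $(Q,g_Q,J')$ such that $(\mathrm{range}\,\pi_* )^\perp$ is totally geodesic. If $\beta$ is a geodesic on $(P,g_P)$, then the curve $\eta=\pi\circ\beta$ is a geodesic on $Q$ if and only if $$\begin{aligned} &\cos^2\theta\,\pi_*(\nabla^P_X X)+S_{\delta(\alpha\pi_*X)}\pi_*X-\pi_*\big(\nabla^P_X\,{}^*\pi_*B(\delta\pi_*X)\big)+S_{C(\delta\pi_*X)}\pi_*X+\cos^2\theta\,\nabla^Q_U\pi_*X-\nabla^Q_UB(\delta\pi_*X)\\ &-B\big((\nabla\pi_* )(X,{}^*\pi_*BU)\big)-\alpha\pi_*(\nabla^P_X\,{}^*\pi_*BU)+\alpha(S_{CU}\pi_*X)-B(\nabla^{\pi\perp}_XCU)-\alpha(\nabla^Q_UBU)-B(\nabla^{\pi\perp}_UCU)=0 \end{aligned}$$ and $$\begin{aligned} &\cos^2\theta\,(\nabla\pi_* )(X,X)-\nabla^{\pi\perp}_X\delta(\alpha\pi_*X)-(\nabla\pi_* )(X,{}^*\pi_*B(\delta\pi_*X))-\nabla^{\pi\perp}_XC(\delta\pi_*X)-\nabla^{\pi\perp}_U\delta(\alpha\pi_*X)-\nabla^{\pi\perp}_UC(\delta\pi_*X)\\ &-C\big((\nabla\pi_* )(X,{}^*\pi_*BU)\big)-\delta\pi_*(\nabla^P_X\,{}^*\pi_*BU)-\delta(\nabla^Q_UBU)-C(\nabla^{\pi\perp}_UCU)-C(\nabla^{\pi\perp}_XCU)+\delta(S_{CU}\pi_*X)=0,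 \end{aligned}$$ where $\pi_*X\in\Gamma(\mathrm{range}\,\pi_* )$ (with $X\in\Gamma((\ker\pi_* )^\perp)$) and $U\in\Gamma((\mathrm{range}\,\pi_* )^\perp)$ are respectively the vertical and horizontal parts of $\dot\eta$.
   Context: A smooth map $\pi:(P,g_P)\to(Q,g_Q)$ between Riemannian manifolds is a Riemannian map if $g_Q(\pi_*X,\pi_*Y)=g_P(X,Y)$ for all $X,Y\in\Gamma((\ker\pi_* )^\perp)$. One has $TP=\ker\pi_*\oplus(\ker\pi_* )^\perp$, and along $\pi$, $TQ=\mathrm{range}\,\pi_*\oplus(\mathrm{range}\,\pi_* )^\perp$ (with $(\mathrm{range}\,\pi_* )^\perp\ne0$). For vectors tangent to $Q$, ''vertical'' means lying in $\mathrm{range}\,\pi_*$ and ''horizontal'' means lying in $(\mathrm{range}\,\pi_* )^\perp$. A Kähler manifold $(Q,g_Q,J')$: $J'^2=-I$, $g_Q(J'X,J'Y)=g_Q(X,Y)$, and $\nabla^QJ'=0$. A Riemannian map to an almost Hermitian manifold is slant with slant angle $\theta$ if for every non-zero $X\in\Gamma((\ker\pi_* )^\perp)$ the angle between $J'\pi_*X$ and $\mathrm{range}\,\pi_*$ is the constant $\theta$, independent of the point and of the vector. $\nabla^P,\nabla^Q$ are the Levi-Civita connections, $\nabla^{Q_\pi}$ is the pullback connection of $\nabla^Q$ along $\pi$. The second fundamental form is $(\nabla\pi_* )(X,Y)=\nabla^{Q_\pi}_X\pi_*Y-\pi_*(\nabla^P_XY)$. For $X\in\Gamma((\ker\pi_*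 )^\perp)$ and $V\in\Gamma((\mathrm{range}\,\pi_* )^\perp)$, write $\nabla^Q_{\pi_*X}V=-S_V\pi_*X+\nabla^{\pi\perp}_XV$, with $S_V\pi_*X$ the $\mathrm{range}\,\pi_*$-component (up to sign) and $\nabla^{\pi\perp}_XV$ the orthogonal component; for horizontal $U$, $\nabla^{\pi\perp}_UV$ is the $(\mathrm{range}\,\pi_* )^\perp$-component of $\nabla^Q_UV$. ${}^*\pi_*$ is the adjoint of $\pi_*$: $g_Q(\pi_*X,W)=g_P(X,{}^*\pi_*W)$. For $\pi_*Y\in\Gamma(\mathrm{range}\,\pi_* )$ write $J'\pi_*Y=\alpha\pi_*Y+\delta\pi_*Y$ with $\alpha\pi_*Y\in\Gamma(\mathrm{range}\,\pi_* )$, $\delta\pi_*Y\in\Gamma((\mathrm{range}\,\pi_* )^\perp)$; for $U\in\Gamma((\mathrm{range}\,\pi_* )^\perp)$ write $J'U=BU+CU$ with $BU\in\Gamma(\mathrm{range}\,\pi_* )$, $CU\in\Gamma((\mathrm{range}\,\pi_* )^\perp)$. *)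

(* Defs.v *)
From HB Require Import structures.
From mathcomp Require Import all_boot all_order all_algebra.
From mathcomp Require Import all_classical all_reals all_analysis.
From mathcomp Require Import ring.

Set Implicit Arguments.
Unset Strict Implicit.
Unset Printing Implicit Defensive.

Import Order.TTheory GRing.Theory Num.Theory.
Import numFieldNormedType.Exports.

Local Open Scope classical_set_scope.
Local Open Scope ring_scope.

Section Smoothness.
Context {R : realType} {E F : normedModType R}.

(* On an open set of a finite-dimensional space this is the usual class C^k:
   the directional derivatives in all directions are again required to be of
   class C^(k-1). *)
Fixpoint Ck (k : nat) (A : set E) (f : E -> F) : Prop :=
  if k is k'.+1 then
    (forall x, A x -> differentiable f x) /\
    (forall v, Ck k' A (fun x => 'D_v f x))
  else forall x, A x -> {for x, continuous f}.

Definition smooth_on (A : set E) (f : E -> F) := forall k, Ck k A f.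

Definition smooth_near (x : E) (f : E -> F) :=
  exists2 A : set E, open A /\ A x & smooth_on A f.

End Smoothness.

(* The atlas is indexed by the points of the manifold: [chart p] is a chart on
   the open set [cdom p] containing p, and [chartV p] is its inverse.  Every
   smooth structure is generated by such an atlas. *)
Record manifold (R : realType) (n : nat) := Manifold {
  mfd_sort :> topologicalType;
  cdom : mfd_sort -> set mfd_sort;
  chart : mfd_sort -> mfd_sort -> 'rV[R]_n;
  chartV : mfd_sort -> 'rV[R]_n -> mfd_sort;
  mfd_hausdorff : hausdorff_space mfd_sort;
  mfd_countable : @second_countable mfd_sort;
  cdom_open : forall p, open (cdom p);
  cdom_self : forall p, cdom p p;
  chartK : forall p q, cdom p q -> chartV p (chart p q) = q;
  chart_open : forall p, open (chart p @` cdom p);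
  chart_continuous : forall p q, cdom p q -> {for q, continuous (chart p)};
  chartV_continuous : forall p q, cdom p q ->
    {for chart p q, continuous (chartV p)};
  chart_smooth : forall p q,
    smooth_on (chart p @` (cdom p `&` cdom q)) (chart q \o chartV p) }.

Section Manifolds.
Context {R : realType} {n : nat} (M : manifold R n).

(* A tangent vector at q is given by its components, a row vector, in the
   preferred chart [chart q]; tensors at q are matrices in that chart.  Matrices
   act on row vectors from the right.  [tin c q] turns components in [chart q]
   into components in [chart c], and [tout c q] does the converse. *)
Definition tin (c q : M) : 'M[R]_n :=
  jacobian (chart c \o chartV q) (chart q q).
Definition tout (c q : M) : 'M[R]_n :=
  jacobian (chart q \o chartV c) (chart c q).

Definition smooth_vfield (X : M -> 'rV[R]_n) (p : M) :=
  smooth_near (chart p p) (fun x => X (chartV p x) *m tin p (chartV p x)).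

Definition smooth_endo (E : M -> 'M[R]_n) (p : M) :=
  smooth_near (chart p p)
    (fun x => tout p (chartV p x) *m E (chartV p x) *m tin p (chartV p x)).

Definition gram (g : M -> 'M[R]_n) (c : M) (x : 'rV[R]_n) : 'M[R]_n :=
  tout c (chartV c x) *m g (chartV c x) *m (tout c (chartV c x))^T.

End Manifolds.

Section InnerProduct.
Context {R : realType} {n : nat} (G : 'M[R]_n).

Definition inner (u v : 'rV[R]_n) : R := (u *m G *m v^T) 0 0.

Definition inner_product :=
  G^T = G /\ (forall v : 'rV[R]_n, v != 0 -> 0 < inner v v).

(* Linear subspaces are row spaces of matrices. *)
Definition perp k (A : 'M[R]_(k, n)) (v : 'rV[R]_n) :=
  forall w : 'rV[R]_n, (w <= A)%MS -> inner v w = 0.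

(* The orthogonal projection onto the row space of A; see [oprojP]. *)
Definition oproj k (A : 'M[R]_(k, n)) : 'M[R]_n :=
  let B := row_base A in G *m B^T *m invmx (B *m G *m B^T) *m B.

Definition gnorm (v : 'rV[R]_n) : R := Num.sqrt (inner v v).

Definition angle_subspace k (w : 'rV[R]_n) (A : 'M[R]_(k, n)) : R :=
  acos (gnorm (w *m oproj A) / gnorm w).

End InnerProduct.

Section RiemannianManifolds.
Context {R : realType} {n : nat} {M : manifold R n}.

Definition riemannian_metric (g : M -> 'M[R]_n) :=
  forall p, inner_product (g p) /\ smooth_near (chart p p) (gram g p).

(* Christoffel symbols of the Levi-Civita connection at the point c in the chart
   [chart c], where the matrix of the metric at c is [g c]; see
   [christoffel_torsion_free] and [christoffel_metric]. *)
Definition dgram (g : M -> 'M[R]_n) (c : M) (i j l : 'I_n) : R :=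
  'D_(delta_mx 0 l) (fun x => gram g c x i j : R^o) (chart c c).

Definition christoffel (g : M -> 'M[R]_n) (c : M) (k i j : 'I_n) : R :=
  2^-1 * \sum_l invmx (g c) k l *
    (dgram g c j l i + dgram g c i l j - dgram g c i j l).

(* Covariant derivative at x, in the direction w, of the section V along the map
   f, where q = f x and w belongs to a vector space E of parameters:
   (D_w V)^k + Gamma^k_ij (D_w f)^i V^j in the chart [chart q]. *)
Definition cov_param (E : normedModType R) (g : M -> 'M[R]_n) (q : M)
    (f : E -> M) (V : E -> 'rV[R]_n) (x w : E) : 'rV[R]_n :=
  'D_w (fun y => V y *m tin q (f y)) x +
  \row_k \sum_i \sum_j
     christoffel g q k i j * ('D_w (chart q \o f) x) 0 i * V x 0 j.

Definition velocity (c : R -> M) (t : R) : 'rV[R]_n :=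
  'D_(1 : R^o) (chart (c t) \o c : R^o -> 'rV[R]_n) t.

Definition geodesic (g : M -> 'M[R]_n) (I : set R) (c : R -> M) :=
  forall t, I t ->
    [/\ {for t, continuous c},
        smooth_near (t : R^o) (chart (c t) \o c : R^o -> 'rV[R]_n) &
        cov_param g (c t) (c : R^o -> M) (velocity c) t 1 = 0].

End RiemannianManifolds.

Section Maps.
Context {R : realType} {m n : nat} {M : manifold R m} {N : manifold R n}.

Definition smooth_map (f : M -> N) :=
  forall p, {for p, continuous f} /\
    smooth_near (chart p p) (chart (f p) \o f \o chartV p).

Definition tmap (f : M -> N) (p : M) : 'M[R]_(m, n) :=
  jacobian (chart (f p) \o f \o chartV p) (chart p p).

(* The pullback along f of the Levi-Civita connection of g, applied to the
   section V along f; f = id gives the Levi-Civita connection itself. *)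
Definition cov (g : N -> 'M[R]_n) (f : M -> N) (V : M -> 'rV[R]_n)
    (p : M) (w : 'rV[R]_m) : 'rV[R]_n :=
  cov_param g (f p) (f \o chartV p) (V \o chartV p) (chart p p) w.

End Maps.

Definition nabla {R : realType} {n : nat} {M : manifold R n}
    (g : M -> 'M[R]_n) (V : M -> 'rV[R]_n) (p : M) (w : 'rV[R]_n) :=
  cov g (@id M) V p w.

Definition kaehler {R : realType} {n : nat} {M : manifold R n}
    (g J : M -> 'M[R]_n) :=
  [/\ riemannian_metric g,
      forall p, smooth_endo J p,
      forall p, J p *m J p = - 1%:M,
      forall p u v, inner (g p) (u *m J p) (v *m J p) = inner (g p) u v &
      forall p V w, smooth_vfield V p ->
        nabla g (fun q => V q *m J q) p w = nabla g V p w *m J p].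

Section RiemannianMaps.
Context {R : realType} {m n : nat} {P : manifold R m} {Q : manifold R n}.
Variables (gP : P -> 'M[R]_m) (gQ J : Q -> 'M[R]_n) (f : P -> Q).

Definition riemannian_map :=
  smooth_map f /\
  forall p u v,
    perp (gP p) (kermx (tmap f p)) u -> perp (gP p) (kermx (tmap f p)) v ->
    inner (gQ (f p)) (u *m tmap f p) (v *m tmap f p) = inner (gP p) u v.

Definition slant (theta : R) :=
  forall p X, perp (gP p) (kermx (tmap f p)) X -> X != 0 ->
    angle_subspace (gQ (f p)) (X *m tmap f p *m J (f p)) (tmap f p) = theta.

(* See [adjointP]. *)
Definition adjoint (p : P) : 'M[R]_(n, m) :=
  gQ (f p) *m (tmap f p)^T *m invmx (gP p).

Definition second_fundamental_form (X Y : P -> 'rV[R]_m) (p : P) : 'rV[R]_n :=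
  cov gQ f (fun p' => Y p' *m tmap f p') p (X p)
  - nabla gP Y p (X p) *m tmap f p.

(* The range of the differential of f is given along f only.  To differentiate
   in directions normal to it, it is read near f p0 as a distribution D of Q,
   the row spaces of the matrices [D q]; such a distribution is smooth when the
   orthogonal projection onto it is. *)
Definition range_distribution (p0 : P) (D : Q -> 'M[R]_n) :=
  (\forall p \near p0, (D (f p) == tmap f p)%MS) /\
  smooth_endo (fun q => oproj (gQ q) (D q)) (f p0).

End RiemannianMaps.

Section Distributions.
Context {R : realType} {n : nat} {Q : manifold R n}.
Variables (g J D : Q -> 'M[R]_n).

Definition perp_totally_geodesic (q0 : Q) :=
  \forall q \near q0, forall U V : Q -> 'rV[R]_n,
    smooth_vfield U q -> smooth_vfield V q ->
    (\forall r \near q, perp (g r) (D r) (U r)) ->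
    (\forall r \near q, perp (g r) (D r) (V r)) ->
    perp (g q) (D q) (nabla g V q (U q)).

Definition vert (q : Q) (w : 'rV[R]_n) : 'rV[R]_n := w *m oproj (g q) (D q).
Definition hor (q : Q) (w : 'rV[R]_n) : 'rV[R]_n := w - vert q w.

(* alpha and delta are the vertical and horizontal parts of J on vertical
   vectors, B and C those of J on horizontal vectors. *)
Definition alpha (q : Q) (w : 'rV[R]_n) : 'rV[R]_n := vert q (w *m J q).
Definition delta (q : Q) (w : 'rV[R]_n) : 'rV[R]_n := hor q (w *m J q).
Definition Bmap (q : Q) (w : 'rV[R]_n) : 'rV[R]_n := vert q (w *m J q).
Definition Cmap (q : Q) (w : 'rV[R]_n) : 'rV[R]_n := hor q (w *m J q).

(* [weingarten f V X] and [nperp f V X], for V a section along f normal to the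
   range, are S_V f_* X and the normal derivative of V along X; [nperpU V U] is
   the normal part of the derivative of the vector field V in the direction U. *)
Definition weingarten m (P : manifold R m) (f : P -> Q) (V : P -> 'rV[R]_n)
    (X : P -> 'rV[R]_m) (p : P) : 'rV[R]_n := - vert (f p) (cov g f V p (X p)).
Definition nperp m (P : manifold R m) (f : P -> Q) (V : P -> 'rV[R]_n)
    (X : P -> 'rV[R]_m) (p : P) : 'rV[R]_n := hor (f p) (cov g f V p (X p)).
Definition nperpU (V U : Q -> 'rV[R]_n) (q : Q) : 'rV[R]_n :=
  hor q (nabla g V q (U q)).

End Distributions.

(* X, W and U are local sections, near b t and f (b t), whose values along the
   curves b and f \o b give the vertical part W = f_* X and the horizontal part
   U of the velocity of f \o b.  That f_* X is the restriction W \o f of a vector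
   field of Q is what gives a meaning to its derivative in the direction U.  Such
   sections exist at every t where the velocity of f \o b is nonzero. *)
Definition velocity_sections {R : realType} {m n : nat} {P : manifold R m}
    {Q : manifold R n} (gP : P -> 'M[R]_m) (gQ : Q -> 'M[R]_n) (f : P -> Q)
    (D : Q -> 'M[R]_n) (b : R -> P) (t : R)
    (X : P -> 'rV[R]_m) (W U : Q -> 'rV[R]_n) :=
  [/\ smooth_vfield X (b t) /\
        (\forall p \near b t, perp (gP p) (kermx (tmap f p)) (X p)),
      smooth_vfield W (f (b t)) /\
        (\forall q \near f (b t), (W q <= D q)%MS),
      smooth_vfield U (f (b t)) /\
        (\forall q \near f (b t), perp (gQ q) (D q) (U q)),
      \forall p \near b t, X p *m tmap f p = W (f p) &
      \forall s \near t,
        W (f (b s)) = vert gQ D (f (b s)) (velocity (f \o b) s) /\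
        U (f (b s)) = hor gQ D (f (b s)) (velocity (f \o b) s)].

Section LeviCivita.
Context {R : realType} {n : nat}.

Lemma inner_product_unitmx (G : 'M[R]_n) : inner_product G -> G \in unitmx.
Proof.
move=> [_ pos]; rewrite -row_free_unit -kermx_eq0; apply/rowV0P => v.
move=> /sub_kermxP vG0; apply/eqP; apply/negPn/negP => /pos.
by rewrite /inner vG0 mul0mx mxE ltxx.
Qed.

Lemma oprojP (G : 'M[R]_n) k (A : 'M[R]_(k, n)) (w : 'rV[R]_n) :
  inner_product G ->
  (w *m oproj G A <= A)%MS /\ perp G A (w - w *m oproj G A).
Proof.
move=> [sG pos]; rewrite /oproj.
move: (row_base A) (eq_row_base A) (row_base_free A) => B eqB freeB /=.
have unitS : B *m G *m B^T \in unitmx.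
  rewrite -row_free_unit -kermx_eq0; apply/rowV0P => v /sub_kermxP vS0.
  apply/eqP; rewrite -(mulmx_free_eq0 v freeB).
  apply/negPn/negP => /pos; rewrite /inner trmx_mul mulmxA.
  by rewrite !mulmxA in vS0; rewrite vS0 mul0mx mxE ltxx.
split; first by rewrite !mulmxA -eqB submxMl.
move=> v; rewrite -eqB => /submxP[u ->]; rewrite /inner trmx_mul.
have -> : (w - w *m (G *m B^T *m invmx (B *m G *m B^T) *m B)) *m G *m
    (B^T *m u^T) = w *m G *m B^T *m u^T - w *m G *m B^T *m
      (invmx (B *m G *m B^T) *m (B *m G *m B^T)) *m u^T.
  by rewrite !mulmxBl !mulmxA.
by rewrite mulVmx // mulmx1 subrr mxE.
Qed.

Lemma dgram_sym (M : manifold R n) (g : M -> 'M[R]_n) c i j l :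
  riemannian_metric g -> dgram g c i j l = dgram g c j i l.
Proof.
move=> hg; rewrite /dgram.
suff -> : (fun x => gram g c x i j : R^o) = (fun x => gram g c x j i) by [].
apply/funext => x.
have {1}-> : gram g c x = (gram g c x)^T; last by rewrite mxE.
by rewrite /gram !trmx_mul trmxK (hg _).1.1 mulmxA.
Qed.

Lemma christoffel_torsion_free (M : manifold R n) (g : M -> 'M[R]_n) c k i j :
  riemannian_metric g -> christoffel g c k i j = christoffel g c k j i.
Proof.
move=> hg.
rewrite /christoffel; congr (_ * _); apply: eq_bigr => l _.
by rewrite (dgram_sym c i j _ hg) [dgram g c j l i + _]addrC.
Qed.

Lemma christoffel_metric (M : manifold R n) (g : M -> 'M[R]_n) c i j l :
  riemannian_metric g ->
  dgram g c i j l =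
    \sum_k (christoffel g c k l i * g c k j + christoffel g c k l j * g c i k).
Proof.
move=> hg.
have ug := inner_product_unitmx (hg c).1.
have gs a b : g c a b = g c b a by rewrite -{1}(hg c).1.1 mxE.
have lower a b e : \sum_k christoffel g c k a b * g c k e =
    2^-1 * (dgram g c b e a + dgram g c a e b - dgram g c a b e).
  under eq_bigr do rewrite /christoffel -mulrA mulr_suml.
  rewrite -mulr_sumr exchange_big /=; congr (_ * _).
  transitivity (\sum_d (dgram g c b d a + dgram g c a d b - dgram g c a b d) *
      (g c *m invmx (g c)) e d).
    apply: eq_bigr => d _; rewrite mxE mulr_sumr; apply: eq_bigr => k _.
    by rewrite (gs e k); ring.
  rewrite (mulmxV ug) (bigD1 e) //= big1 => [|d /negPf de].
    by rewrite mxE eqxx mulr1 addr0.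
  by rewrite mxE eq_sym de mulr0.
rewrite big_split /= lower.
under [X in _ + X]eq_bigr do rewrite (gs i).
rewrite lower (dgram_sym c j i l hg) (dgram_sym c l j i hg).
by rewrite (dgram_sym c l i j hg); field.
Qed.

End LeviCivita.

Lemma adjointP (R : realType) m n (P : manifold R m) (Q : manifold R n)
    (gP : P -> 'M[R]_m) (gQ : Q -> 'M[R]_n) (f : P -> Q) (p : P)
    (v : 'rV[R]_m) (w : 'rV[R]_n) :
  inner_product (gP p) -> inner_product (gQ (f p)) ->
  inner (gQ (f p)) (v *m tmap f p) w =
  inner (gP p) v (w *m adjoint gP gQ f p).
Proof.
move=> hP [sQ _]; have uP := inner_product_unitmx hP; case: hP => sP _.
rewrite /inner /adjoint !trmx_mul trmxK trmx_inv sP sQ -!mulmxA.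
by rewrite (mulmxA (gP p)) mulmxV // mul1mx.
Qed.

(* Main.v *)
Require Import Defs.
From HB Require Import structures.
From mathcomp Require Import all_boot all_order all_algebra.
From mathcomp Require Import all_classical all_reals all_analysis.
From mathcomp Require Import ring lra.

Set Implicit Arguments.
Unset Strict Implicit.
Unset Printing Implicit Defensive.

Import Order.TTheory GRing.Theory Num.Theory.
Import numFieldNormedType.Exports.
Local Open Scope classical_set_scope.
Local Open Scope ring_scope.

(* The velocity of f o b is the image of that of b under df, hence vertical, so its
   horizontal part U vanishes along the curve and every term containing U drops
   out or cancels.  On the range, alpha^2 = - cos^2 theta, so B (delta W) =
   (cos^2 theta - 1) W and delta (alpha W) + C (delta W) = 0.  What is left of the
   two equations is df(nabla_X X) = 0 and (nabla df)(X, X) = 0, while f o b is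
   geodesic at t iff the sum nabla_W W of these two vectors vanishes.  If it does,
   so does each of them, because g_P(nabla_X X, e) = g_Q(nabla_W W, df(e)) for all
   e: the left side is expressed by derivatives of the covector g_P(X, .), which is
   the pullback of g_Q(W, .), and the second derivatives of f cancel by symmetry.

   Conversely, local sections X, W, U exist where the velocity is nonzero, so
   there the equations give the geodesic equation.  Hence the squared speed, whose
   derivative is 2 g(nabla v, v), has derivative 0 everywhere on I, and where the
   velocity vanishes it vanishes on a neighbourhood. *)

(** * Functions of class C^k *)

(** Tensors are stored at each point in the chart attached to that point, so nothing can be
    differentiated before it is rewritten in one fixed chart; [vrep], [gram] and [local_rep] do
    this, and [tin] and [tout] then cancel in pairs. The identities behind the reduction do not hold
    on a neighbourhood in Q: U vanishes only along the curve, and delta (alpha W) + C (delta W) = 0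
    and the value of B (delta W) are known only on the image of f. This suffices, because every
    derivative that survives is either one along f or one in the direction W q, which is the
    velocity of the curve; derivatives in the direction U vanish with U q. The identity g_P(nabla_X
    X, e) = g_Q(nabla_W W, df(e)) contains two facts. For e in the kernel of df it makes nabla_X X
    horizontal, and for e orthogonal to the kernel it makes (nabla df)(X, X) normal to the range.
    These are the reasons why nabla_W W splits into its range part and its normal part, and so why
    one geodesic equation amounts to two equations. *)

Lemma near_open_nbhs (T : topologicalType) (x : T) (P : T -> Prop) :
  (\forall y \near x, P y) -> exists2 A : set T, open A /\ A x & A `<=` P.
Proof. by move=> h; have : nbhs x P by []; rewrite nbhsE /= => -[A]; exists A. Qed.

Lemma continuous_near (T U : topologicalType) (f : T -> U) x (P : U -> Prop) :
  {for x, continuous f} -> (\forall z \near f x, P z) ->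
  \forall y \near x, P (f y).
Proof. by move=> cf fP; have /(_ P fP) := cf. Qed.

Section CkGeneral.
Context {R : realType} {E F : normedModType R}.
Implicit Types (A : set E) (f g : E -> F).

(** The derivatives in [Ck] are those of f on the whole space, never relative to A, so A only lists
    the points at which conditions are tested. *)
Lemma Ck_pointwise k A f :
  (forall x, A x -> Ck k [set x] f) <-> Ck k A f.
Proof.
elim: k f => [|k IH] f /=; first by split=> [h x /h|h x Ax _ ->]; [apply|exact: h].
split=> [h|[h1 h2] x Ax].
  by split=> [x /h[+ _]|v]; [exact|apply/IH => x /h[_ +]].
by split=> [_ ->|v]; [exact: h1|apply: (IH _).2 x Ax; exact: h2].
Qed.

Lemma Ck_sub k A A' f : A' `<=` A -> Ck k A f -> Ck k A' f.
Proof. by move=> sA /Ck_pointwise h; apply/Ck_pointwise => x /sA; exact: h. Qed.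

Lemma CkS k A f : Ck k.+1 A f -> Ck k A f.
Proof.
elim: k f => [|k IH] f [h1 h2]; first by move=> x /h1; exact: differentiable_continuous.
by split=> // v; apply: IH; exact: h2.
Qed.

(** The first-order expansion of f at x is also one of g; by uniqueness of the differential, 'd f x
    is then the differential of g. *)
Lemma near_eq_differentiable f g x :
  (\forall y \near x, f y = g y) -> differentiable f x -> differentiable g x.
Proof.
move=> fg df.
have dfc : continuous ('d f x : E -> F) by exact: diff_continuous.
have key : g \o shift x = cst (g x) + 'd f x +o_ 0 id.
  apply/eqaddoP => _/posnumP[e].
  have /eqaddoP/(_ e%:num ltac:(by [])) fo := diff_locally df.
  have fg0 : \forall h \near 0, f (h + x) = g (h + x).
    by move: fg; rewrite (near_shift 0) /=; apply: filterS => y; rewrite subr0.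
  near=> h.
  have -> : (g \o shift x - (cst (g x) + 'd f x)) h =
            (f \o shift x - (cst (f x) + 'd f x)) h.
    rewrite /= /cst !fctE /=; congr (_ - (_ + _)); last exact/esym/(nbhs_singleton fg).
    by apply/esym; near: h.
  by near: h.
by apply/diff_locallyP; rewrite (diff_unique dfc key).
Unshelve. all: by end_near. Qed.

Lemma Ck_ext k A f g : open A -> (forall x, A x -> f x = g x) ->
  Ck k A f -> Ck k A g.
Proof.
move=> oA; elim: k f g => [|k IH] f g fg.
  move=> h x Ax; have fgx : \forall y \near x, f y = g y.
    by near=> y; apply: fg; near: y; exact: open_nbhs_nbhs.
  have := h _ Ax; rewrite /prop_for /continuous_at (fg _ Ax); apply: cvg_trans.
  exact: near_eq_cvg.
case=> h1 h2; have fgx x : A x -> \forall y \near x, f y = g y.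
  by move=> Ax; near=> y; apply: fg; near: y; exact: open_nbhs_nbhs.
split=> [x Ax|v]; first by apply: near_eq_differentiable (h1 _ Ax); exact: fgx.
by apply: IH (h2 v) => x Ax; apply: near_eq_derive; exact: fgx.
Unshelve. all: by end_near. Qed.

(** One neighbourhood has to serve every order k. Testing at single points turns this into a
    property of the points near x, which can be intersected and transported like any other. *)
Lemma smooth_nearP x f :
  smooth_near x f <-> \forall y \near x, smooth_on [set y] f.
Proof.
split=> [[A [oA Ax] h]|].
  near=> y => k; apply: Ck_sub (h k) => _ ->.
  by near: y; exact: open_nbhs_nbhs.
case/near_open_nbhs => A [oA Ax] h; exists A => // k.
by apply/Ck_pointwise => y /h; exact.
Unshelve. all: by end_near. Qed.

Lemma smooth_near_nbhs x f :
  smooth_near x f -> \forall y \near x, smooth_near y f.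
Proof. by move/smooth_nearP => /near_join; apply: filterS => y /smooth_nearP. Qed.

Lemma smooth_near_differentiable x f : smooth_near x f -> differentiable f x.
Proof. by case=> A [_ Ax] /(_ 1%N)[+ _]; exact. Qed.

Lemma smooth_near_derive x f v : smooth_near x f -> smooth_near x ('D_v f).
Proof. by case=> A oA h; exists A => // k; apply: (h k.+1).2. Qed.

Lemma smooth_near_continuous x f : smooth_near x f -> {for x, continuous f}.
Proof. by move/smooth_near_differentiable/differentiable_continuous. Qed.

Lemma smooth_near_ext x f g : (\forall y \near x, f y = g y) ->
  smooth_near x f -> smooth_near x g.
Proof.
case/near_open_nbhs => A [oA Ax] fg [B [oB Bx] h].
exists (A `&` B); first by split; [exact: openI|].
move=> k; apply: (@Ck_ext _ _ f); first exact: openI.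
  by move=> y [/fg].
by apply: Ck_sub (h k) => y [].
Qed.

End CkGeneral.

(** * Sums, products and inverses of smooth functions *)

Section SmoothScalar.
Context {R : realType} {E : normedModType R}.

Section Cst.
Context {F : normedModType R}.

Lemma Ck_cst k (A : set E) (c : F) : Ck k A (fun=> c).
Proof.
elim: k c => [|k IH] c /=; first by move=> x _; exact: cvg_cst.
split=> [x _|v]; first exact: differentiable_cst.
have -> : (fun x => 'D_v (fun=> c) x) = fun=> 0 :> F; last exact: IH.
by apply/funext => x; exact: derive_cst.
Qed.

Lemma CkD k (A : set E) (f g : E -> F) : open A -> Ck k A f -> Ck k A g ->
  Ck k A (fun x => f x + g x).
Proof.
move=> oA; elim: k f g => [|k IH] f g /=.
  by move=> hf hg x Ax; apply: continuousD; [exact: hf|exact: hg].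
move=> [f1 f2] [g1 g2]; split=> [x Ax|v].
  by apply: differentiableD; [exact: f1|exact: g1].
apply: Ck_ext (IH _ _ (f2 v) (g2 v)) => // x Ax; apply/esym.
by apply: deriveD; apply: diff_derivable; [exact: f1|exact: g1].
Qed.

Lemma smooth_near_cst (x : E) (c : F) : smooth_near x (fun=> c).
Proof. by exists setT => [|k]; [split; [exact: openT|]|exact: Ck_cst]. Qed.

Lemma smooth_nearD (x : E) (f g : E -> F) :
  smooth_near x f -> smooth_near x g -> smooth_near x (fun y => f y + g y).
Proof.
move=> [A [oA Ax] hA] [B [oB Bx] hB].
have oAB := openI oA oB; exists (A `&` B) => // k.
by apply: CkD => //; [apply: Ck_sub (hA k)|apply: Ck_sub (hB k)] => y [].
Qed.

Lemma smooth_near_sum (x : E) I (r : seq I) (f : I -> E -> F) :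
  (forall i, smooth_near x (f i)) -> smooth_near x (fun y => \sum_(i <- r) f i y).
Proof.
move=> h; elim: r => [|i r IH].
  by apply: smooth_near_ext (smooth_near_cst x 0); apply: nearW => y; rewrite big_nil.
by apply: smooth_near_ext (smooth_nearD (h i) IH); apply: nearW => y; rewrite big_cons.
Qed.

End Cst.

Lemma smooth_near_id (x : E) : smooth_near x (fun y : E => y).
Proof.
exists setT => [|k]; first by split; [exact: openT|].
elim: k => [|k _]; first by move=> y _; exact: cvg_id.
split=> [y _|v]; first by have [] := is_diff_id y.
have := Ck_cst k setT v; apply: Ck_ext; first exact: openT.
by move=> y _; rewrite derive_id.
Qed.

Lemma CkM k (A : set E) (f g : E -> R) : open A -> Ck k A f -> Ck k A g ->
  Ck k A (fun x => f x * g x).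
Proof.
move=> oA; elim: k f g => [|k IH] f g.
  by move=> hf hg x Ax; apply: (@continuousM R E f g); [exact: hf|exact: hg].
move=> f0 g0; have [f1 f2] := f0; have [g1 g2] := g0; split=> [x Ax|v].
  by apply: (@differentiableM R E f g); [exact: f1|exact: g1].
have := CkD oA (IH _ _ (CkS f0) (g2 v)) (IH _ _ (CkS g0) (f2 v)).
apply: Ck_ext => // x Ax; apply/esym.
rewrite [LHS](@deriveM R E f g); [|exact/diff_derivable/f1|exact/diff_derivable/g1].
by rewrite /GRing.scale.
Qed.

Lemma CkV k (A : set E) (f : E -> R) : open A -> (forall x, A x -> f x != 0) ->
  Ck k A f -> Ck k A (fun x => (f x)^-1).
Proof.
move=> oA f0; elim: k => [|k IH].
  by move=> hf x Ax; apply: (@continuousV R E f); [exact: f0|exact: hf].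
move=> h; have [f1 f2] := h; split=> [x Ax|v].
  by apply: (@differentiableV R E f); [exact: f1|exact: f0].
have hV := IH (CkS h); have hVV := CkM oA hV hV.
have hN := CkM oA (Ck_cst k A (-1 : R)) (CkM oA hVV (f2 v)).
apply: Ck_ext hN => // x Ax; apply/esym.
rewrite [LHS](@deriveV R E f); last 2 first.
  exact: f0.
  by apply: diff_derivable; exact: f1.
by rewrite /GRing.scale /= mulN1r mulNr -exprVn expr2.
Qed.

Lemma smooth_nearM (x : E) (f g : E -> R) :
  smooth_near x f -> smooth_near x g -> smooth_near x (fun y => f y * g y).
Proof.
move=> [A [oA Ax] hA] [B [oB Bx] hB].
have oAB := openI oA oB; exists (A `&` B) => // k.
by apply: CkM => //; [apply: Ck_sub (hA k)|apply: Ck_sub (hB k)] => y [].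
Qed.

Lemma smooth_nearV (x : E) (f : E -> R) : f x != 0 ->
  smooth_near x f -> smooth_near x (fun y => (f y)^-1).
Proof.
move=> fx0 h; have : \forall y \near x, f y != 0 /\ smooth_on [set y] f.
  apply: filterI; last exact/smooth_nearP.
  apply: (continuous_near (P := fun z => z != 0) (smooth_near_continuous h)).
  by apply: open_nbhs_nbhs; split => //; exact: open_neq.
case/near_open_nbhs => A [oA Ax] hA; exists A => // k.
apply: CkV => //; first by move=> y /hA[].
by apply/Ck_pointwise => y /hA[_ +]; exact.
Qed.

Lemma smooth_near_prod (x : E) I (r : seq I) (f : I -> E -> R) :
  (forall i, smooth_near x (f i)) -> smooth_near x (fun y => \prod_(i <- r) f i y).
Proof.
move=> h; elim: r => [|i r IH].
  have := smooth_near_cst x (1 : R); apply: smooth_near_ext.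
  by apply: nearW => y; rewrite big_nil.
have := smooth_nearM (h i) IH; apply: smooth_near_ext.
by apply: nearW => y; rewrite big_cons.
Qed.

End SmoothScalar.

(** * Matrix-valued functions *)

Section MatrixCalculus.
Context {R : realType} {E : normedModType R}.

Lemma differentiable_mx m n (A : E -> 'M[R]_(m, n)) x :
  (forall i j, differentiable (fun y => A y i j) x) -> differentiable A x.
Proof.
move=> h; have -> : A = \sum_(i < m) \sum_(j < n)
    (fun y => A y i j *: (delta_mx i j : 'M[R]_(m, n))).
  apply/funext => y; rewrite fct_sumE {1}[A y]matrix_sum_delta.
  by apply: eq_bigr => i _; rewrite fct_sumE.
by do 2!apply: differentiable_sum => ?; exact: differentiableZl.
Qed.

Lemma differentiable_entry m n (A : E -> 'M[R]_(m, n)) x i j :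
  differentiable A x -> differentiable (fun y => A y i j) x.
Proof.
by move=> dA; exact: differentiable_comp dA (differentiable_coord (A x) i j).
Qed.

Lemma derive_entry m n (A : E -> 'M[R]_(m, n)) x v i j :
  differentiable A x -> ('D_v A x) i j = 'D_v (fun y => A y i j) x.
Proof. by move=> /diff_derivable dA; rewrite derive_mx // mxE. Qed.

Lemma derive_mulmx m n p (A : E -> 'M[R]_(m, n)) (B : E -> 'M[R]_(n, p)) x v :
  differentiable A x -> differentiable B x ->
  differentiable (fun y => A y *m B y) x /\
  'D_v (fun y => A y *m B y) x = 'D_v A x *m B x + A x *m 'D_v B x.
Proof.
move=> dA dB.
have dM i j k : differentiable (fun y => A y i j * B y j k) x.
  by apply: differentiableM; exact: differentiable_entry.
have e i k : (fun y => (A y *m B y) i k) =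
    \sum_(j < n) (fun y => A y i j * B y j k).
  by apply/funext => y; rewrite mxE fct_sumE.
have dAB : differentiable (fun y => A y *m B y) x.
  by apply: differentiable_mx => i k; rewrite e; exact: differentiable_sum.
split=> //; apply/matrixP => i k; rewrite derive_entry // e.
rewrite derive_sum => [|j]; last exact: diff_derivable.
rewrite !mxE -big_split; apply: eq_bigr => j _ /=.
rewrite !derive_entry // [LHS]deriveM /GRing.scale /=; last 2 first.
- exact/diff_derivable/differentiable_entry.
- exact/diff_derivable/differentiable_entry.
by rewrite [LHS]addrC; congr (_ + _); rewrite mulrC.
Qed.

Lemma differentiable_trmx m n (A : E -> 'M[R]_(m, n)) x :
  differentiable A x -> differentiable (fun y => (A y)^T) x.
Proof.
move=> dA; apply: differentiable_mx => i j.
have -> : (fun y => (A y)^T i j) = (fun y => A y j i).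
  by apply/funext => y; rewrite mxE.
exact: differentiable_entry.
Qed.

Lemma derive_trmx m n (A : E -> 'M[R]_(m, n)) x v :
  differentiable A x -> 'D_v (fun y => (A y)^T) x = ('D_v A x)^T.
Proof.
move=> dA; apply/matrixP => i j; rewrite derive_entry; last exact: differentiable_trmx.
rewrite mxE derive_entry //; congr ('D_v _ x).
by apply/funext => y; rewrite mxE.
Qed.

Lemma Ck_entry m n (A : E -> 'M[R]_(m, n)) k (S : set E) i j :
  open S -> Ck k S A -> Ck k S (fun y => A y i j).
Proof.
move=> oS; elim: k A => [|k IH] A.
  move=> hA y Sy; have dc := differentiable_coord (A y) i j.
  exact: continuous_comp (hA _ Sy) (differentiable_continuous dc).
move=> [h1 h2]; split=> [y Sy|v]; first by apply: differentiable_entry; exact: h1.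
have := IH _ (h2 v); apply: Ck_ext => // y Sy.
by rewrite derive_entry //; exact: h1.
Qed.

Lemma smooth_near_entry m n (A : E -> 'M[R]_(m, n)) x i j :
  smooth_near x A -> smooth_near x (fun y => A y i j).
Proof. by move=> [S oS hS]; exists S => // k; apply: Ck_entry oS.1 (hS k). Qed.

Lemma smooth_nearZl (F : normedModType R) (c : E -> R) (w : F) x :
  smooth_near x c -> smooth_near x (fun y => c y *: w).
Proof.
move=> [S [oS Sx] hS]; exists S => // k; move: (hS k); elim: k c {hS} => [|k IH] c.
  by move=> hc y Sy; apply: continuousZl; exact: hc.
move=> [h1 h2]; split=> [y Sy|v]; first by apply: differentiableZl; exact: h1.
have := IH _ (h2 v); apply: Ck_ext => // y Sy.
have dc := h1 _ Sy.
rewrite !deriveE //; last exact: differentiableZl.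
by rewrite diffZl.
Qed.

Lemma smooth_near_mx m n (A : E -> 'M[R]_(m, n)) x :
  (forall i j, smooth_near x (fun y => A y i j)) -> smooth_near x A.
Proof.
move=> h; have : smooth_near x (fun y => \sum_(i < m) \sum_(j < n)
    A y i j *: (delta_mx i j : 'M[R]_(m, n))).
  by do 2!apply: smooth_near_sum => ?; exact: smooth_nearZl.
by apply: smooth_near_ext; apply: nearW => y; rewrite -matrix_sum_delta.
Qed.

Lemma smooth_near_mulmx m n p (A : E -> 'M[R]_(m, n)) (B : E -> 'M[R]_(n, p)) x :
  smooth_near x A -> smooth_near x B -> smooth_near x (fun y => A y *m B y).
Proof.
move=> hA hB; apply: smooth_near_mx => i k.
have : smooth_near x (fun y => \sum_j A y i j * B y j k).
  by apply: smooth_near_sum => j; apply: smooth_nearM; exact: smooth_near_entry.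
by apply: smooth_near_ext; apply: nearW => y; rewrite mxE.
Qed.

Lemma smooth_near_trmx m n (A : E -> 'M[R]_(m, n)) x :
  smooth_near x A -> smooth_near x (fun y => (A y)^T).
Proof.
move=> hA; apply: smooth_near_mx => i j; have := smooth_near_entry j i hA.
by apply: smooth_near_ext; apply: nearW => y; rewrite mxE.
Qed.

Lemma smooth_near_det n (A : E -> 'M[R]_n) x :
  smooth_near x A -> smooth_near x (fun y => \det (A y)).
Proof.
move=> hA; apply: smooth_near_sum => s; apply: smooth_nearM.
  exact: smooth_near_cst.
by apply: smooth_near_prod => i; exact: smooth_near_entry.
Qed.

(** Cramer's rule: the entries are cofactors over the determinant. [invmx] returns its argument
    where the determinant is zero, so the formula is only used near x, where the determinant stays
    nonzero. *)
Lemma smooth_near_invmx n (A : E -> 'M[R]_n) x : A x \in unitmx ->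
  smooth_near x A -> smooth_near x (fun y => invmx (A y)).
Proof.
move=> uA hA; have hd := smooth_near_det hA.
have d0 : \det (A x) != 0 by rewrite -unitfE -unitmxE.
have : smooth_near x (fun y => \matrix_(i, j) ((\det (A y))^-1 * cofactor (A y) j i)).
  apply: smooth_near_mx => i j.
  have : smooth_near x (fun y => (\det (A y))^-1 * cofactor (A y) j i).
    apply: smooth_nearM; first exact: smooth_nearV.
    apply: smooth_nearM; first exact: smooth_near_cst.
    apply: smooth_near_det; apply: smooth_near_mx => k l.
    have := smooth_near_entry (lift j k) (lift i l) hA.
    by apply: smooth_near_ext; apply: nearW => y; rewrite !mxE.
  by apply: smooth_near_ext; apply: nearW => y; rewrite mxE.
apply: smooth_near_ext.
have : \forall y \near x, \det (A y) != 0.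
  apply: (continuous_near (P := fun z => z != 0) (smooth_near_continuous hd)).
  by apply: open_nbhs_nbhs; split => //; exact: open_neq.
apply: filterS => y dy; rewrite /invmx unitmxE unitfE dy.
by apply/matrixP => i j; rewrite !mxE.
Qed.

Lemma smooth_nearN m n (A : E -> 'M[R]_(m, n)) x :
  smooth_near x A -> smooth_near x (fun y => - A y).
Proof.
move=> hA; have := smooth_near_mulmx hA (smooth_near_cst x (- 1%:M)).
by apply: smooth_near_ext; apply: nearW => y; rewrite mulmxN mulmx1.
Qed.

End MatrixCalculus.

(** * The chain rule and smoothness of composites *)

Section Composition.
Context {R : realType} {E V : normedModType R}.

Lemma derive_comp (F : normedModType R) (f : E -> V) (g : V -> F) x v :
  differentiable f x -> differentiable g (f x) ->
  'D_v (g \o f) x = 'D_('D_v f x) g (f x).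
Proof.
move=> df dg; rewrite deriveE; last exact: differentiable_comp.
by rewrite diff_comp //= !deriveE.
Qed.

(* [c] and [e] are the coordinates and the vectors of a basis of V. *)
Lemma Ck_comp n (c : 'I_n -> V -> R) (e : 'I_n -> V) :
  (forall v, v = \sum_i c i v *: e i) ->
  (forall k (A : set E) (f : E -> V) i, open A -> Ck k A f -> Ck k A (c i \o f)) ->
  forall k (A : set E) (B : set V) (f : E -> V) (g : V -> R), open A ->
  (forall x, A x -> B (f x)) -> Ck k A f -> Ck k B g -> Ck k A (g \o f).
Proof.
move=> ce cC k A B f g oA fAB; elim: k f g fAB => [|k IH] f g fAB.
  by move=> hf hg x Ax; exact: continuous_comp (hf _ Ax) (hg _ (fAB _ Ax)).
move=> f0 g0; have [f1 f2] := f0; have [g1 g2] := g0; split=> [x Ax|v].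
  exact: differentiable_comp (f1 _ Ax) (g1 _ (fAB _ Ax)).
(* The derivative of g is taken in a direction that moves with x, to which the hypothesis on g does
   not apply. Expanding it in the basis leaves only the fixed directions [e i]. *)
have : Ck k A (fun x => \sum_i c i ('D_v f x) * 'D_(e i) g (f x)).
  elim: (index_enum _) => [|i r IHr].
    by apply: Ck_ext (Ck_cst k A (0 : R)) => // x _; rewrite big_nil.
  have ci := CkM oA (cC _ _ _ i oA (f2 v)) (IH _ _ fAB (CkS f0) (g2 (e i))).
  by apply: Ck_ext (CkD oA ci IHr) => // x _; rewrite big_cons.
apply: Ck_ext => // x Ax; have gx := g1 _ (fAB _ Ax).
rewrite [RHS](derive_comp _ (f1 _ Ax) gx).
rewrite [RHS]deriveE // [X in _ = _ X]ce linear_sum; apply: eq_bigr => i _.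
by rewrite linearZ /=; congr (_ * _); rewrite deriveE.
Qed.

End Composition.

Section SmoothComposition.
Context {R : realType} {E : normedModType R}.

Lemma smooth_near_comp_rV n p q (f : E -> 'rV[R]_n) (g : 'rV[R]_n -> 'M[R]_(p, q)) x :
  smooth_near x f -> smooth_near (f x) g -> smooth_near x (g \o f).
Proof.
move=> hf hg; apply: smooth_near_mx => i j.
have /smooth_nearP hg' := smooth_near_entry i j hg.
have [B [oB Bfx] hB] := near_open_nbhs hg'.
have hfB : \forall y \near x, B (f y).
  have nB : \forall z \near f x, B z by exact: open_nbhs_nbhs.
  exact: continuous_near (smooth_near_continuous hf) nB.
have /smooth_nearP hf' := hf.
have [A [oA Ax] hA] := near_open_nbhs (filterI hfB hf').
exists A => // k.
refine (@Ck_comp R E _ n (fun i (v : 'rV_n) => v 0 i) (delta_mx 0) _ _ k A B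
  f (fun y => g y i j) oA _ _ _); last first.
- by apply/Ck_pointwise => y /hB; exact.
- by apply/Ck_pointwise => y /hA[_]; exact.
- by move=> y /hA[].
- by move=> k' A' f' i' oA'; exact: Ck_entry.
- by move=> v; exact: row_sum_delta.
Qed.

Lemma smooth_near_comp_R p q (f : E -> R) (g : R -> 'M[R]_(p, q)) x :
  smooth_near x f -> smooth_near (f x) g -> smooth_near x (g \o f).
Proof.
move=> hf hg; apply: smooth_near_mx => i j.
have /smooth_nearP hg' := smooth_near_entry i j hg.
have [B [oB Bfx] hB] := near_open_nbhs hg'.
have hfB : \forall y \near x, B (f y).
  have nB : \forall z \near f x, B z by exact: open_nbhs_nbhs.
  exact: continuous_near (smooth_near_continuous hf) nB.
have /smooth_nearP hf' := hf.
have [A [oA Ax] hA] := near_open_nbhs (filterI hfB hf').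
exists A => // k.
refine (@Ck_comp R E _ 1 (fun=> id) (fun=> 1) _ _ k A B f (fun y => g y i j) oA _ _ _);
  last first.
- by apply/Ck_pointwise => y /hB; exact.
- by apply/Ck_pointwise => y /hA[_]; exact.
- by move=> y /hA[].
- by [].
- by move=> v; rewrite big_ord1 [RHS]mulr1.
Qed.

End SmoothComposition.

(** * Symmetry of second derivatives *)

Section Schwarz.
Context {R : realType} {E : normedModType R}.

Lemma is_derive_line (g : E -> R) (y u : E) (s : R) :
  differentiable g (y + s *: u) ->
  is_derive s (1 : R) (fun r : R => g (y + r *: u)) ('D_u g (y + s *: u)).
Proof.
move=> dg; have dZ : differentiable (fun r : R => r *: u) s by exact: differentiableZl.
have dl : differentiable (fun r : R => y + r *: u) s.
  by apply: differentiableD => //; exact: differentiable_cst.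
have dlE : 'D_1 (fun r : R => y + r *: u) s = u.
  rewrite [LHS]deriveE // [X in X 1](diffD (differentiable_cst y s) dZ) diff_cst diffZl //.
  by rewrite /= add0r diff_val scale1r.
have := derive_comp (1 : R^o) dl dg; rewrite dlE => <-.
apply/derivableP/diff_derivable; exact: differentiable_comp dl dg.
Qed.

(** The mean value theorem is applied twice: to the increment of g along v as a function of the
    coefficient of u, which gives a, and then to 'D_u g along v, which gives b. *)
Lemma second_difference (A : set E) (g : E -> R) x (u v : E) (h : R) : 0 < h ->
  (forall a b : R, 0 <= a <= h -> 0 <= b <= h -> A (x + a *: u + b *: v)) ->
  Ck 2 A g ->
  exists a b : R, [/\ 0 <= a <= h, 0 <= b <= h &
    g (x + h *: u + h *: v) - g (x + h *: u) - g (x + h *: v) + g x =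
    h * h * 'D_v ('D_u g) (x + a *: u + b *: v)].
Proof.
move=> h0 hA [g1 g2].
have l0 : 0 <= (0 : R) <= h by rewrite lexx ltW.
have lh : 0 <= h <= h by rewrite lexx ltW.
pose p s := g (x + h *: v + s *: u) - g (x + s *: u).
have dp (s : R) : 0 <= s <= h ->
    is_derive s (1 : R) p ('D_u g (x + h *: v + s *: u) - 'D_u g (x + s *: u)).
  move=> sh; apply: is_deriveB; apply: is_derive_line; apply: g1.
    by rewrite addrAC; exact: hA.
  by have := hA s 0 sh l0; rewrite scale0r addr0.
have cp (q dq : R -> R) : (forall s : R, 0 <= s <= h -> is_derive s 1 q (dq s)) ->
    exists2 s : R, 0 <= s <= h & q h - q 0 = h * dq s.
  move=> hq; have [||s + e] := @MVT R q dq 0 h h0.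
  - by move=> s; rewrite in_itv /= => /andP[/ltW s0 /ltW sh]; apply: hq; rewrite s0.
  - apply: derivable_within_continuous => s; rewrite in_itv /= => sh.
    by case: (hq _ sh).
  rewrite in_itv /= => /andP[/ltW s0 /ltW sh]; exists s; first by rewrite s0.
  by rewrite e subr0 mulrC.
have [a ah ea] := cp _ _ dp.
have [b bh eb] := cp (fun r => 'D_u g (x + a *: u + r *: v)) _ (fun r rh =>
   is_derive_line (u := v) ((g2 u).1 _ (hA _ _ ah rh))).
exists a, b; split=> //; rewrite -mulrA -eb.
have -> : 'D_u g (x + a *: u + h *: v) - 'D_u g (x + a *: u + 0 *: v) =
  'D_u g (x + h *: v + a *: u) - 'D_u g (x + a *: u).
  by rewrite scale0r addr0 addrAC.
rewrite -ea /p !scale0r !addr0 opprB addrA [x + h *: v + _]addrAC.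
by rewrite addrAC.
Qed.

(** The second difference is symmetric in u and v, so the two mixed derivatives take a common value
    at two points close to x; continuity of both at x brings their values there within any e. *)
Lemma derive_schwarz (g : E -> R) x (u v : E) : smooth_near x g ->
  'D_u ('D_v g) x = 'D_v ('D_u g) x.
Proof.
move=> sg; apply/eqP; rewrite -subr_eq0 -normr_le0; apply/ler_addgt0Pl => e e0.
rewrite addr0.
have cuv := smooth_near_continuous (smooth_near_derive u (smooth_near_derive v sg)).
have cvu := smooth_near_continuous (smooth_near_derive v (smooth_near_derive u sg)).
have e20 : 0 < e / 2 by rewrite divr_gt0.
move/cvgrPdist_le/(_ _ e20) : cuv => cuv; move/cvgrPdist_le/(_ _ e20) : cvu => cvu.
have /smooth_nearP sg' := sg.
have [r /= r0 rA] := (nbhs_ballP _ _).1 (filterI sg' (filterI cuv cvu)).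
(* This size keeps the parallelogram spanned by h u and h v inside the ball of radius r; adding 1
   keeps the denominator nonzero when u = v = 0. *)
pose h := r / (2 * (`|u| + `|v| + 1)).
have d0 : 0 < 2 * (`|u| + `|v| + 1) by rewrite mulr_gt0 // addr_gt0 // addr_ge0.
have h0 : 0 < h by rewrite divr_gt0.
have hh0 : h * h != 0 by rewrite mulf_neq0 ?gt_eqF.
have close (p q s1 s2 : R) : `|p - s1| <= e / 2 -> `|q - s2| <= e / 2 -> s1 = s2 ->
    `|p - q| <= e.
  move=> h1 h2 e12; rewrite [e]splitr (le_trans _ (lerD h1 h2)) // e12.
  by rewrite [`|q - _|]distrC (le_trans _ (ler_normD _ _)) // addrA subrK.
have hball (a b : R) : 0 <= a <= h -> 0 <= b <= h -> ball x r (x + a *: u + b *: v).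
  move=> /andP[a0 ah] /andP[b0 bh]; rewrite -ball_normE /ball_ /= -addrA opprD addNKr normrN.
  apply: (@le_lt_trans _ _ (h * (`|u| + `|v|))).
    apply: (le_trans (ler_normD _ _)); rewrite !normrZ !ger0_norm // mulrDr.
    by rewrite lerD // ler_wpM2r.
  rewrite /h mulrAC ltr_pdivrMr // ltr_pM2l // mulrDr mulr_natl mulr1.
  by rewrite (@le_lt_trans _ _ ((`|u| + `|v|) *+ 2)) ?ltrDl // mulr2n lerDl addr_ge0.
have C2 : Ck 2 (ball x r) g.
  by apply/Ck_pointwise => y /rA[+ _]; exact.
have hball' (a b : R) : 0 <= a <= h -> 0 <= b <= h -> ball x r (x + a *: v + b *: u).
  by move=> ah bh; rewrite addrAC; exact: hball.
have [a [b [ah bh]]] := second_difference h0 hball' C2.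
have [a' [b' [ah' bh']]] := second_difference h0 hball C2.
move=> e1 e2; have e3 (a1 a2 a3 a4 a5 : R) : a1 = a2 ->
    a1 - a3 - a4 + a5 = a2 - a4 - a3 + a5 by move=> ->; congr (_ + _); exact: addrAC.
have eab := etrans (esym e1) (etrans (e3 _ _ _ _ _ (congr1 g (addrAC _ _ _))) e2).
have {}eab := mulfI hh0 eab.
have [_ [c1 _]] := rA _ (hball' _ _ ah bh).
have [_ [_ c2]] := rA _ (hball _ _ ah' bh').
exact: close c1 c2 (esym eab).
Qed.

End Schwarz.

(** The inverse function theorem in one variable. By the mean value theorem g is injective where its
    derivative has no zero; the inverse is continuous, and the formula for its derivative carries
    the smoothness. *)
Lemma smooth_local_inverse {R : realType} (g : R -> R) (t : R) :
  smooth_near t g -> 'D_1 g t != 0 ->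
  exists2 s : R -> R, smooth_near (g t) s & \forall r \near t, s (g r) = r.
Proof.
move=> sg g't.
have /smooth_nearP sg' := sg.
have nz : \forall r \near t, 'D_1 g r != 0.
  have n0 : \forall z \near 'D_1 g t, z != 0.
    by apply: open_nbhs_nbhs; split => //; exact: open_neq.
  exact: continuous_near (smooth_near_continuous (smooth_near_derive (1 : R^o) sg)) n0.
have [e /= e0 eA] := (nbhs_ballP _ _).1 (filterI sg' nz).
have dg r : ball t e r -> is_derive r 1 g ('D_1 g r).
  by move=> /eA[/(_ 1%N)[+ _] _] => /(_ _ erefl)/diff_derivable dr; exact: derivableP.
have inj_lt a b : ball t e a -> ball t e b -> a < b -> g a <> g b.
  move=> ea eb ab gab.
  have sub z : z \in `[a, b] -> ball t e z.
    rewrite in_itv /= => /andP[az zb]; move: ea eb.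
    rewrite -!ball_normE /ball_ /= !ltr_distlC => /andP[h1 _] /andP[_ h2].
    by rewrite (lt_le_trans h1 az) (le_lt_trans zb h2).
  have [||z + ez] := @MVT R g ('D_1 g) a b ab.
  - by move=> z zab; apply/dg/sub; exact: subset_itv_oo_cc zab.
  - apply: derivable_within_continuous => z /sub/dg; by case.
  rewrite gab subrr in ez => zab; have /eA[_] := sub _ (subset_itv_oo_cc zab).
  move/eqP: ez; rewrite eq_sym mulf_eq0 subr_eq0 [b == a]gt_eqF // orbF.
  by move=> ->.
(* Only preimages inside the ball are eligible, and [inj_lt] makes them unique; off the image of the
   ball the value is a default. *)
pose s y := get [set r | ball t e r /\ g r = y].
have sK r : ball t e r -> s (g r) = r.
  move=> er; have [es gs] : [set r' | ball t e r' /\ g r' = g r] (s (g r)).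
    exact: (@getI _ [set r' | ball t e r' /\ g r' = g r] r).
  have [lt|lt|//] := ltgtP (s (g r)) r; first by have := inj_lt _ _ es er lt.
  by have := inj_lt _ _ er es lt; rewrite gs.
have nt : \forall r \near t, ball t e r by exact: nbhsx_ballx.
exists s; last by near=> r; apply: sK; near: r.
have gs1 : {near g t, cancel s g}.
  apply: near_continuous_can_sym; near=> r; last by apply: sK; near: r.
  have : ball t e r by near: r.
  by move=> /dg[/derivable1_diffP/differentiable_continuous].
have gs2 : {near g t, continuous s}.
  apply: near_can_continuous; near=> r; first by apply: sK; near: r.
  have : ball t e r by near: r.
  by move=> /dg[/derivable1_diffP/differentiable_continuous].
have sgt : s (g t) = t by exact/sK/ballxx.
have es : \forall y \near g t, ball t e (s y).
  have cs := nbhs_singleton gs2.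
  by apply: (continuous_near (P := ball t e) cs); rewrite sgt.
have [B [oB Bgt] hB] := near_open_nbhs (filterI gs1 es).
have ds y : B y -> is_derive y 1 s ('D_1 g (s y))^-1.
  move=> /hB[gsy esy]; rewrite -[X in is_derive X]gsy.
  have nr : \forall r \near s y, ball t e r.
    by apply: open_nbhs_nbhs; split=> //; exact: ball_open.
  apply: is_derive_inverse.
  - by near=> r; apply: sK; near: r.
  - near=> r; have : ball t e r by near: r.
    by move=> /dg[/derivable1_diffP/differentiable_continuous].
  - exact: dg.
  - by have [] := eA _ esy.
(* Bootstrap: the derivative of s is the inverse of 'D_1 g composed with s, so it is as regular as
   s, and s gains one order at each round. *)
exists B => // k; elim: k => [|k IH].
  by move=> y /ds[/derivable1_diffP/differentiable_continuous].
split=> [y /ds[/derivable1_diffP]//|v].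
have ck : Ck k B (fun y => 'D_1 g (s y)).
  refine (@Ck_comp R _ _ 1 (fun=> id) (fun=> 1) _ _ k B (ball t e) s ('D_1 g) oB _ _ _).
  - by move=> v'; rewrite big_ord1 [RHS]mulr1.
  - by [].
  - by move=> y /hB[].
  - exact: IH.
  - by apply/Ck_pointwise => y /eA[/(_ k.+1)[_ +] _]; exact.
have cV : Ck k B (fun y => ('D_1 g (s y))^-1).
  by apply: CkV => // y /hB[_ /eA[]].
have := CkM oB (Ck_cst k B v) cV; apply: Ck_ext => // y By.
have [dy <-] := ds _ By; have ddy := (derivable1_diffP _ _).1 dy.
rewrite !deriveE // -[X in _ = 'd _ _ X]mulr1.
by rewrite [RHS]linearZ.
Unshelve. all: by end_near. Qed.

(** * Charts *)

Lemma jacobian_eq {R : realType} m n (f : 'rV[R]_m -> 'rV[R]_n) x A :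
  differentiable f x -> (forall v, 'D_v f x = v *m A) -> jacobian f x = A.
Proof.
move=> df h; apply/row_matrixP => i.
by rewrite !rowE -deriveEjacobian.
Qed.

Lemma jacobian_comp {R : realType} m n p (f : 'rV[R]_m -> 'rV[R]_n)
    (g : 'rV[R]_n -> 'rV[R]_p) x :
  differentiable f x -> differentiable g (f x) ->
  jacobian (g \o f) x = jacobian f x *m jacobian g (f x).
Proof.
move=> df dg; apply: jacobian_eq => [|v]; first exact: differentiable_comp.
by rewrite derive_comp // !deriveEjacobian // mulmxA.
Qed.

Lemma near_eq_jacobian {R : realType} m n (f g : 'rV[R]_m -> 'rV[R]_n) x :
  (\forall y \near x, f y = g y) -> differentiable f x -> jacobian g x = jacobian f x.
Proof.
move=> fg df; apply: jacobian_eq; first exact: near_eq_differentiable df.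
by move=> v; rewrite -(near_eq_derive _ fg) deriveEjacobian.
Qed.

Lemma smooth_near_jacobian {R : realType} m n (f : 'rV[R]_m -> 'rV[R]_n) x :
  smooth_near x f -> smooth_near x (jacobian f).
Proof.
move=> sf; apply: smooth_near_mx => i j.
have := smooth_near_entry 0 j (smooth_near_derive (delta_mx 0 i) sf).
apply: smooth_near_ext; apply: filterS (smooth_near_nbhs sf) => y.
by move=> /smooth_near_differentiable dy; rewrite deriveEjacobian // -rowE mxE.
Qed.

Section Charts.
Context {R : realType} {n : nat} {M : manifold R n}.
Implicit Types (c d p q : M).

Lemma near_cdom c q : cdom c q -> \forall r \near q, cdom c r.
Proof. by move=> cq; apply: open_nbhs_nbhs; split=> //; exact: cdom_open. Qed.

Lemma near_chart (c q : M) (S : M -> Prop) : cdom c q ->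
  (\forall r \near q, S r) -> \forall x \near chart c q, S (chartV c x).
Proof.
move=> cq Sq; apply: (continuous_near (chartV_continuous cq)).
by rewrite chartK.
Qed.

Lemma chartVK (c q : M) : cdom c q ->
  \forall x \near chart c q, cdom c (chartV c x) /\ chart c (chartV c x) = x.
Proof.
move=> cq; have : nbhs (chart c q) (chart c @` cdom c).
  by apply: open_nbhs_nbhs; split; [exact: chart_open|exists q].
by apply: filterS => x [r cr <-]; rewrite chartK.
Qed.

Lemma transition_smooth c d q : cdom c q -> cdom d q ->
  smooth_near (chart c q) (chart d \o chartV c).
Proof.
move=> cq dq; apply/smooth_nearP.
apply: filterS2 (chartVK cq) (near_chart cq (near_cdom dq)) => x [cx xE] dx k.
apply: Ck_sub (chart_smooth c d k) => _ ->.
by exists (chartV c x).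
Qed.

Lemma jacobian_transition c d e q : cdom c q -> cdom d q -> cdom e q ->
  jacobian (chart d \o chartV c) (chart c q) *m
    jacobian (chart e \o chartV d) (chart d q) =
  jacobian (chart e \o chartV c) (chart c q).
Proof.
move=> cq dq eq; have dcd := smooth_near_differentiable (transition_smooth cq dq).
have dde := smooth_near_differentiable (transition_smooth dq eq).
have dce := smooth_near_differentiable (transition_smooth cq eq).
have dE : (chart d \o chartV c) (chart c q) = chart d q by rewrite /= chartK.
rewrite -dE in dde *; rewrite -(jacobian_comp dcd dde).
apply: near_eq_jacobian dce.
apply: filterS (near_chart cq (near_cdom dq)) => x dx /=.
by rewrite chartK.
Qed.

Lemma jacobian_chart_id c q : cdom c q ->
  jacobian (chart c \o chartV c) (chart c q) = 1%:M.
Proof.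
move=> cq; apply: jacobian_eq.
  exact: smooth_near_differentiable (transition_smooth cq cq).
move=> v; have -> : 'D_v (chart c \o chartV c) (chart c q) = 'D_v id (chart c q).
  by apply: near_eq_derive; apply: filterS (chartVK cq) => x [].
by rewrite derive_id mulmx1.
Qed.

Lemma tin_tout c q : cdom c q -> tin c q *m tout c q = 1%:M.
Proof.
by move=> cq; rewrite /tin /tout jacobian_transition ?jacobian_chart_id //; exact: cdom_self.
Qed.

Lemma tout_tin c q : cdom c q -> tout c q *m tin c q = 1%:M.
Proof.
by move=> cq; rewrite /tin /tout jacobian_transition ?jacobian_chart_id //; exact: cdom_self.
Qed.

Lemma tin_self q : tin q q = 1%:M.
Proof. by rewrite /tin jacobian_chart_id //; exact: cdom_self. Qed.

Lemma tout_self q : tout q q = 1%:M.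
Proof. by rewrite /tout jacobian_chart_id //; exact: cdom_self. Qed.

Lemma chartV_self q : chartV q (chart q q) = q.
Proof. by rewrite chartK //; exact: cdom_self. Qed.

(** The field in the coordinates of the single chart c. The components X q refer to a chart that
    changes with q, so this is the function whose derivatives have a meaning. *)
Definition vrep (c : M) (X : M -> 'rV[R]_n) (x : 'rV[R]_n) : 'rV[R]_n :=
  X (chartV c x) *m tin c (chartV c x).

Lemma vrep_self (p : M) (X : M -> 'rV[R]_n) : vrep p X (chart p p) = X p.
Proof. by rewrite /vrep chartV_self tin_self mulmx1. Qed.

Lemma gram_self (g : M -> 'M[R]_n) p : gram g p (chart p p) = g p.
Proof. by rewrite /gram chartV_self tout_self mul1mx trmx1 mulmx1. Qed.

Lemma inner_gram (g : M -> 'M[R]_n) p q u v : cdom p q ->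
  inner (gram g p (chart p q)) (u *m tin p q) (v *m tin p q) = inner (g q) u v.
Proof.
move=> pq; rewrite /inner /gram chartK // trmx_mul.
have e : (tout p q)^T *m (tin p q)^T = 1%:M by rewrite -trmx_mul tin_tout // trmx1.
rewrite -!mulmxA (mulmxA (tin p q)) tin_tout // mul1mx.
by rewrite (mulmxA (tout p q)^T) e mul1mx.
Qed.

Lemma smooth_vfieldD (X Y : M -> 'rV[R]_n) p : smooth_vfield X p ->
  smooth_vfield Y p -> smooth_vfield (fun q => X q + Y q) p.
Proof.
move=> sX sY; have := smooth_nearD sX sY; apply: smooth_near_ext.
by near=> x; rewrite mulmxDl.
Unshelve. all: by end_near.
Qed.

Lemma smooth_vfieldN (X : M -> 'rV[R]_n) p : smooth_vfield X p ->
  smooth_vfield (fun q => - X q) p.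
Proof.
move=> sX; have := smooth_nearN sX; apply: smooth_near_ext.
by near=> x; rewrite mulNmx.
Unshelve. all: by end_near.
Qed.

Lemma smooth_vfieldZ (a : R) (X : M -> 'rV[R]_n) p : smooth_vfield X p ->
  smooth_vfield (fun q => a *: X q) p.
Proof.
move=> sX; have := smooth_near_mulmx sX (smooth_near_cst (chart p p) a%:M).
apply: smooth_near_ext; near=> x; rewrite mul_mx_scalar; exact: scalemxAl.
Unshelve. all: by end_near. Qed.

Lemma smooth_vfield_endo (X : M -> 'rV[R]_n) (A : M -> 'M[R]_n) p :
  smooth_vfield X p -> smooth_endo A p -> smooth_vfield (fun q => X q *m A q) p.
Proof.
move=> sX sA; have := smooth_near_mulmx sX sA; apply: smooth_near_ext.
have := chartVK (cdom_self p); apply: filterS => x [px _].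
by rewrite -!mulmxA (mulmxA (tin p _)) tin_tout // mul1mx.
Qed.

End Charts.

(** * Maps between manifolds in coordinates *)

Section MapsCurves.
Context {R : realType} {m n : nat} {P : manifold R m} {Q : manifold R n}.

Definition local_rep (f : P -> Q) (c : P) (d : Q) : 'rV[R]_m -> 'rV[R]_n :=
  chart d \o f \o chartV c.

(** Smoothness and [tmap] refer to the charts attached to p and f p. Differentiating [tmap f r] in r
    requires fixed charts, hence this comparison with arbitrary ones; it is the chain rule for f
    between two transition maps. *)
Lemma local_rep_smooth (f : P -> Q) p c d : smooth_map f -> cdom c p -> cdom d (f p) ->
  smooth_near (chart c p) (local_rep f c d) /\
  jacobian (local_rep f c d) (chart c p) = tout c p *m tmap f p *m tin d (f p).
Proof.
move=> /(_ p)[cf sf] cp dfp; have pp := cdom_self p; have ff := cdom_self (f p).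
have st := transition_smooth cp pp; have su := transition_smooth ff dfp.
have e1 : chart p p = (chart p \o chartV c) (chart c p) by rewrite /= chartK.
have e2 : chart (f p) (f p) =
    (local_rep f p (f p) \o (chart p \o chartV c)) (chart c p).
  by rewrite /local_rep /= (chartK cp) chartV_self.
rewrite /tmap /tin {}e1 in sf *; rewrite {}e2 in su *.
have sc := smooth_near_comp_rV st sf.
have scc := smooth_near_comp_rV sc su.
have e : \forall x \near chart c p, ((chart d \o chartV (f p)) \o
    (local_rep f p (f p) \o (chart p \o chartV c))) x = local_rep f c d x.
  have h : \forall r \near p, cdom p r /\ cdom (f p) (f r).
    exact: filterI (near_cdom pp) (continuous_near cf (near_cdom ff)).
  have := near_chart cp h; apply: filterS => x [px fx].
  by rewrite /local_rep /= !chartK.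
have j1 := near_eq_jacobian e (smooth_near_differentiable scc).
have j2 := jacobian_comp (smooth_near_differentiable sc) (smooth_near_differentiable su).
have j3 := jacobian_comp (smooth_near_differentiable st) (smooth_near_differentiable sf).
split; first exact: smooth_near_ext scc.
exact: etrans j1 (etrans j2 (congr1 (mulmx^~ _) j3)).
Qed.

End MapsCurves.

(** * Covariant derivatives *)

Section Covariant.
Context {R : realType} {n : nat} {M : manifold R n}.
Variable g : M -> 'M[R]_n.

Definition christoffel_form (p : M) (u v : 'rV[R]_n) : 'rV[R]_n :=
  \row_k \sum_i \sum_j christoffel g p k i j * u 0 i * v 0 j.

Lemma christoffel_form_is_linear p a u u' v :
  christoffel_form p (a *: u + u') v =
  a *: christoffel_form p u v + christoffel_form p u' v.
Proof.
apply/rowP => k; rewrite !mxE mulr_sumr -big_split; apply: eq_bigr => i _ /=.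
rewrite mulr_sumr -big_split; apply: eq_bigr => j _ /=.
by rewrite !mxE mulrDr mulrDl; congr (_ + _); rewrite mulrCA !mulrA.
Qed.

Lemma christoffel_formr_is_linear p a u v v' :
  christoffel_form p u (a *: v + v') =
  a *: christoffel_form p u v + christoffel_form p u v'.
Proof.
apply/rowP => k; rewrite !mxE mulr_sumr -big_split; apply: eq_bigr => i _ /=.
rewrite mulr_sumr -big_split; apply: eq_bigr => j _ /=.
by rewrite !mxE mulrDr; congr (_ + _); rewrite mulrCA.
Qed.

Lemma christoffel_form0r p u : christoffel_form p u 0 = 0.
Proof.
have := christoffel_formr_is_linear p (-1) u 0 0.
by rewrite scaler0 addr0 scaleN1r addNr.
Qed.

Lemma christoffel_form0l p v : christoffel_form p 0 v = 0.
Proof.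
have := christoffel_form_is_linear p (-1) 0 0 v.
by rewrite scaler0 addr0 scaleN1r addNr.
Qed.

Lemma nabla_vrep (X : M -> 'rV[R]_n) p w :
  nabla g X p w = 'D_w (vrep p X) (chart p p) + christoffel_form p w (X p).
Proof.
rewrite /nabla /cov /cov_param; congr (_ + _).
have e : 'D_w (chart (id p) \o (id \o chartV p)) (chart p p) = w.
  apply: etrans (derive_id (chart p p) w); apply: near_eq_derive.
  by have := chartVK (cdom_self p); apply: filterS => x [].
rewrite e; apply/rowP => k; rewrite !mxE.
by rewrite /comp chartV_self.
Qed.

Lemma nabla0 (X : M -> 'rV[R]_n) p : nabla g X p 0 = 0.
Proof. by rewrite nabla_vrep derive0 christoffel_form0l addr0. Qed.

Lemma nablaD (X Y : M -> 'rV[R]_n) p w : smooth_vfield X p -> smooth_vfield Y p ->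
  nabla g (fun q => X q + Y q) p w = nabla g X p w + nabla g Y p w.
Proof.
move=> /smooth_near_differentiable/diff_derivable dX.
move=> /smooth_near_differentiable/diff_derivable dY.
rewrite !nabla_vrep addrACA; congr (_ + _).
  have -> : vrep p (fun q => X q + Y q) = vrep p X + vrep p Y.
    by apply/funext => x; exact: mulmxDl.
  exact: deriveD (dX w) (dY w).
by have := christoffel_formr_is_linear p 1 w (X p) (Y p); rewrite !scale1r.
Qed.

Lemma nablaZ (X : M -> 'rV[R]_n) (a : R) p w : smooth_vfield X p ->
  nabla g (fun q => a *: X q) p w = a *: nabla g X p w.
Proof.
move=> /smooth_near_differentiable/diff_derivable dX.
rewrite !nabla_vrep scalerDr; congr (_ + _).
  have -> : vrep p (fun q => a *: X q) = a *: vrep p X.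
    by apply/funext => x; exact/esym/scalemxAl.
  exact: deriveZ (dX w).
have := christoffel_formr_is_linear p a w (X p) 0.
by rewrite christoffel_form0r !addr0.
Qed.

Lemma cov_curve (c : R -> M) (V : R -> 'rV[R]_n) (W : M -> 'rV[R]_n) t :
  {for t, continuous c} ->
  smooth_near (t : R^o) (chart (c t) \o c : R^o -> 'rV[R]_n) ->
  smooth_vfield W (c t) -> (\forall s \near t, V s = W (c s)) ->
  cov_param g (c t) (c : R^o -> M) V t 1 = nabla g W (c t) (velocity c t).
Proof.
move=> cc sc sW VW; rewrite nabla_vrep /cov_param.
have VWt : V t = W (c t) := nbhs_singleton VW.
rewrite VWt.
have e : 'D_1 (fun s : R^o => V s *m tin (c t) (c s) : 'rV[R]_n) (t : R^o) =
    'D_(velocity c t) (vrep (c t) W) (chart (c t) (c t)).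
  apply: etrans (derive_comp (1 : R^o) (smooth_near_differentiable sc)
    (smooth_near_differentiable sW)).
  apply: near_eq_derive.
  have cn : \forall s \near t, cdom (c t) (c s).
    exact: continuous_near cc (near_cdom (cdom_self (c t))).
  by apply: filterS (filterI VW cn) => s [-> cs]; rewrite /vrep /= chartK.
by rewrite -e.
Qed.

(** A covariant derivative in the direction of a curve sees the field along that curve only. This is
    what allows identities that hold only on the curve to be differentiated. *)
Lemma nabla_velocity0 (c : R -> M) (W : M -> 'rV[R]_n) t :
  {for t, continuous c} ->
  smooth_near (t : R^o) (chart (c t) \o c : R^o -> 'rV[R]_n) ->
  smooth_vfield W (c t) -> (\forall s \near t, W (c s) = 0) ->
  nabla g W (c t) (velocity c t) = 0.
Proof.
move=> cc sc sW W0; rewrite -(@cov_curve c (fun=> 0)) //; last first.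
  by apply: filterS W0 => s ->.
rewrite /cov_param -/(christoffel_form _ _ _) christoffel_form0r addr0.
apply: etrans (derive_cst (0 : 'rV[R]_n) (t : R^o) (1 : R^o)).
by apply: near_eq_derive; near=> s; rewrite mul0mx.
Unshelve. all: by end_near. Qed.

End Covariant.

Section CovariantMaps.
Context {R : realType} {m n : nat} {P : manifold R m} {Q : manifold R n}.
Variables (g : Q -> 'M[R]_n) (f : P -> Q).

Lemma near_eq_cov (V V' : P -> 'rV[R]_n) p w :
  (\forall r \near p, V r = V' r) -> cov g f V p w = cov g f V' p w.
Proof.
move=> VV'; rewrite /cov /cov_param.
have e0 : (V \o chartV p) (chart p p) = (V' \o chartV p) (chart p p).
  by rewrite /comp chartV_self (nbhs_singleton VV').
have e : 'D_w (fun x => (V \o chartV p) x *m tin (f p) ((f \o chartV p) x)) (chart p p) =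
    'D_w (fun x => (V' \o chartV p) x *m tin (f p) ((f \o chartV p) x)) (chart p p).
  apply: near_eq_derive; have := near_chart (cdom_self p) VV'.
  by apply: filterS => x /= ->.
by rewrite e0 e.
Qed.

Lemma cov_comp (W : Q -> 'rV[R]_n) p w : smooth_map f -> smooth_vfield W (f p) ->
  cov g f (W \o f) p w = nabla g W (f p) (w *m tmap f p).
Proof.
move=> sf sW; have [cf sfp] := sf p.
have df := smooth_near_differentiable sfp.
have e1 : 'D_w (chart (f p) \o (f \o chartV p)) (chart p p) = w *m tmap f p.
  exact: deriveEjacobian.
have e2 : (chart (f p) \o (f \o chartV p)) (chart p p) = chart (f p) (f p).
  by rewrite /comp chartV_self.
have e3 : (W \o f \o chartV p) (chart p p) = W (f p) by rewrite /comp chartV_self.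
have dW : differentiable (vrep (f p) W) ((chart (f p) \o (f \o chartV p)) (chart p p)).
  by rewrite e2; exact: smooth_near_differentiable.
rewrite nabla_vrep /cov /cov_param e1 e3.
have e : 'D_w (fun x => (W \o f \o chartV p) x *m tin (f p) ((f \o chartV p) x))
    (chart p p) = 'D_(w *m tmap f p) (vrep (f p) W) (chart (f p) (f p)).
  rewrite -e1 -e2; apply: etrans (derive_comp w df dW); apply: near_eq_derive.
  have cn : \forall r \near p, cdom (f p) (f r).
    exact: continuous_near cf (near_cdom (cdom_self (f p))).
  have := near_chart (cdom_self p) cn.
  by apply: filterS => x fx; rewrite /vrep /= chartK.
by rewrite -e.
Qed.

End CovariantMaps.

(** * Inner products and their derivatives *)

Section Inner.
Context {R : realType} {n : nat}.
Implicit Types (G : 'M[R]_n) (u v w : 'rV[R]_n).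

Lemma innerDl G u v w : inner G (u + v) w = inner G u w + inner G v w.
Proof. by rewrite /inner !mulmxDl mxE. Qed.

Lemma innerDr G u v w : inner G u (v + w) = inner G u v + inner G u w.
Proof. by rewrite /inner linearD mulmxDr mxE. Qed.

Lemma innerZl G (a : R) u v : inner G (a *: u) v = a * inner G u v.
Proof. by rewrite /inner -!scalemxAl mxE. Qed.

Lemma innerZr G (a : R) u v : inner G u (a *: v) = a * inner G u v.
Proof. by rewrite /inner linearZ -scalemxAr mxE. Qed.

Lemma innerNl G u v : inner G (- u) v = - inner G u v.
Proof. by rewrite -scaleN1r innerZl mulN1r. Qed.

Lemma innerNr G u v : inner G u (- v) = - inner G u v.
Proof. by rewrite -scaleN1r innerZr mulN1r. Qed.

Lemma inner0r G u : inner G u 0 = 0.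
Proof. by rewrite /inner trmx0 mulmx0 mxE. Qed.

Lemma inner0l G u : inner G 0 u = 0.
Proof. by rewrite /inner !mul0mx mxE. Qed.

Lemma innerC G u v : G^T = G -> inner G u v = inner G v u.
Proof.
move=> sG; rewrite /inner.
have -> : u *m G *m v^T = (v *m G *m u^T)^T by rewrite !trmx_mul trmxK sG mulmxA.
by rewrite mxE.
Qed.

Lemma inner_inj G u v : inner_product G -> (forall w, inner G u w = inner G v w) -> u = v.
Proof.
move=> [_ pos] h; apply/eqP; rewrite -subr_eq0; apply/negPn/negP => /pos.
by rewrite innerDl innerNl h subrr ltxx.
Qed.

Lemma differentiable_inner (E : normedModType R) (G : E -> 'M[R]_n) (a b : E -> 'rV[R]_n) x :
  differentiable G x -> differentiable a x -> differentiable b x ->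
  differentiable (fun y => inner (G y) (a y) (b y)) x.
Proof.
move=> dG da db; apply: differentiable_entry.
have [d1 _] := derive_mulmx 0 da dG.
by have [] := derive_mulmx 0 d1 (differentiable_trmx db).
Qed.

Lemma derive_inner (E : normedModType R) (G : E -> 'M[R]_n) (a b : E -> 'rV[R]_n) x (z : E) :
  differentiable G x -> differentiable a x -> differentiable b x ->
  'D_z (fun y => inner (G y) (a y) (b y)) x =
  inner ('D_z G x) (a x) (b x) + inner (G x) ('D_z a x) (b x) +
  inner (G x) (a x) ('D_z b x).
Proof.
move=> dG da db; have [d1 e1] := derive_mulmx z da dG.
have [d2 e2] := derive_mulmx z d1 (differentiable_trmx db).
rewrite -(derive_entry z 0 0 d2) e2 e1 derive_trmx //.
have addE (A B : 'M[R]_1) : (A + B) 0 0 = A 0 0 + B 0 0 by rewrite mxE.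
by rewrite mulmxDl !addE [X in X + _]addrC.
Qed.

End Inner.

Lemma velocity_chart {R : realType} {n : nat} {M : manifold R n} (c : R -> M) d s :
  {for s, continuous c} ->
  smooth_near (s : R^o) (chart (c s) \o c : R^o -> 'rV[R]_n) -> cdom d (c s) ->
  smooth_near (s : R^o) (chart d \o c : R^o -> 'rV[R]_n) /\
  'D_(1 : R^o) (chart d \o c : R^o -> 'rV[R]_n) s = velocity c s *m tin d (c s).
Proof.
move=> cc sc dc; have st := transition_smooth (cdom_self (c s)) dc.
have scc := smooth_near_comp_rV sc st.
have e : \forall r \near (s : R^o), ((chart d \o chartV (c s)) \o
    (chart (c s) \o c : R^o -> 'rV[R]_n)) r = (chart d \o c) r.
  have cn : \forall r \near s, cdom (c s) (c r).
    exact: continuous_near cc (near_cdom (cdom_self (c s))).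
  by move: cn; apply: filterS => r cr /=; rewrite chartK.
split; first exact: smooth_near_ext scc.
apply: etrans (esym (near_eq_derive _ e)) _.
apply: etrans (derive_comp _ (smooth_near_differentiable sc)
  (smooth_near_differentiable st)) _.
exact: deriveEjacobian (smooth_near_differentiable st).
Qed.

(** * The metric and its connection in coordinates *)

Section Metric.
Context {R : realType} {n : nat} {M : manifold R n}.
Variable g : M -> 'M[R]_n.
Hypothesis hg : riemannian_metric g.

(** The connection matrix of the direction u, acting on rows from the right; compatibility with the
    metric becomes a matrix identity, [derive_gram]. *)
Definition christoffel_mx (p : M) (u : 'rV[R]_n) : 'M[R]_n :=
  \matrix_(j, k) \sum_i christoffel g p k i j * u 0 i.

Lemma christoffel_formE p u v : christoffel_form g p u v = v *m christoffel_mx p u.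
Proof.
apply/rowP => k; rewrite !mxE exchange_big; apply: eq_bigr => j _ /=.
by rewrite mxE mulr_sumr; apply: eq_bigr => i _; rewrite mulrC.
Qed.

Lemma christoffel_formC p u v : christoffel_form g p u v = christoffel_form g p v u.
Proof.
apply/rowP => k; rewrite !mxE exchange_big; apply: eq_bigr => j _.
by apply: eq_bigr => i _; rewrite (christoffel_torsion_free _ _ _ _ hg) mulrAC.
Qed.

Lemma gram_differentiable p : differentiable (gram g p) (chart p p).
Proof. by apply: smooth_near_differentiable; case: (hg p). Qed.

Lemma derive_gram p u : 'D_u (gram g p) (chart p p) =
  christoffel_mx p u *m g p + g p *m (christoffel_mx p u)^T.
Proof.
have dG := gram_differentiable p.
apply/matrixP => i j; rewrite derive_entry // [in LHS](row_sum_delta u).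
have dGij := differentiable_entry i j dG.
rewrite deriveE // linear_sum /= !mxE -big_split /=.
transitivity (\sum_l u 0 l * dgram g p i j l).
  apply: eq_bigr => l _; rewrite linearZ /=; congr (_ * _).
  by rewrite -deriveE.
transitivity (\sum_l \sum_k u 0 l *
    (christoffel g p k l i * g p k j + christoffel g p k l j * g p i k)).
  by apply: eq_bigr => l _; rewrite (christoffel_metric _ _ _ _ hg) mulr_sumr.
rewrite exchange_big; apply: eq_bigr => k _ /=.
rewrite !mxE mulr_suml mulr_sumr -big_split; apply: eq_bigr => l _ /=.
ring.
Qed.

Lemma inner_derive_gram p u v e :
  inner ('D_u (gram g p) (chart p p)) v e =
  inner (g p) (christoffel_form g p u v) e + inner (g p) v (christoffel_form g p u e).
Proof.
rewrite derive_gram !christoffel_formE /inner mulmxDr mulmxDl mxE.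
by rewrite trmx_mul !mulmxA.
Qed.

(** The Koszul formula for constant fields: when each derivative of the metric is expanded by
    compatibility, the symmetry of [christoffel_form] cancels all terms except two equal ones. *)
Lemma inner_christoffel_form p u v e :
  2 * inner (g p) (christoffel_form g p u v) e =
  inner ('D_u (gram g p) (chart p p)) v e + inner ('D_v (gram g p) (chart p p)) u e
  - inner ('D_e (gram g p) (chart p p)) u v.
Proof.
have [sg _] := (hg p).1.
have koszul (Dg : 'rV[R]_n -> 'M[R]_n) : (forall u v e, inner (Dg u) v e =
      inner (g p) (christoffel_form g p u v) e + inner (g p) v (christoffel_form g p u e)) ->
    2 * inner (g p) (christoffel_form g p u v) e =
    inner (Dg u) v e + inner (Dg v) u e - inner (Dg e) u v.
  move=> h; rewrite !h (christoffel_formC p v u) (christoffel_formC p e u).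
  rewrite (christoffel_formC p e v) (innerC (christoffel_form g p u e) v sg).
  ring.
exact: (koszul (fun u => 'D_u (gram g p) (chart p p)) (inner_derive_gram p)).
Qed.

(* Only directional derivatives of the covector g(X, .), of g(X, X) and of X
   occur, and the first two are preserved by pullback. *)
Lemma inner_nabla (X : M -> 'rV[R]_n) p e : smooth_vfield X p ->
  2 * inner (g p) (nabla g X p (X p)) e =
  2 * 'D_(X p) (fun x => inner (gram g p x) (vrep p X x) e) (chart p p)
  - 'D_e (fun x => inner (gram g p x) (vrep p X x) (vrep p X x)) (chart p p)
  + 2 * inner (g p) (X p) ('D_e (vrep p X) (chart p p)).
Proof.
move=> sX; have dG := gram_differentiable p.
have dX : differentiable (vrep p X) (chart p p) by exact: smooth_near_differentiable.
have [sg _] := (hg p).1.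
have de : differentiable (fun _ : 'rV[R]_n => e) (chart p p) by exact: differentiable_cst.
have alg (x a b c : 'rV[R]_n) (A B : 'M[R]_n) :
    2 * inner (g p) c e = inner A x e + inner A x e - inner B x x ->
    2 * inner (g p) (a + c) e = 2 * (inner A x e + inner (g p) a e + 0) -
      (inner B x x + inner (g p) b x + inner (g p) x b) + 2 * inner (g p) x b.
  by move=> h; rewrite innerDl mulrDr h (innerC b x sg); ring.
rewrite nabla_vrep (derive_inner _ dG dX de) (derive_inner _ dG dX dX).
rewrite vrep_self gram_self derive_cst inner0r.
exact: alg (inner_christoffel_form p (X p) (X p) e).
Qed.

(** Compatibility with the metric along the curve. Each velocity is given in the chart at its own
    point, so the speed is first rewritten in the chart at c t, where the velocity is the derivative
    [a] of the coordinate curve [y]. *)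
Lemma derive_speed (c : R -> M) t :
  (\forall s \near t, {for s, continuous c} /\
     smooth_near (s : R^o) (chart (c s) \o c : R^o -> 'rV[R]_n)) ->
  is_derive (t : R^o) (1 : R^o)
    (fun s : R^o => inner (g (c s)) (velocity c s) (velocity c s) : R^o)
    (2 * inner (g (c t)) (cov_param g (c t) (c : R^o -> M) (velocity c) t 1) (velocity c t)).
Proof.
move=> hc; have [cc sc] := nbhs_singleton hc; have [sg _] := (hg (c t)).1.
pose q := c t; pose y := (chart q \o c : R^o -> 'rV[R]_n).
pose a : R^o -> 'rV[R]_n := 'D_(1 : R^o) y.
have cn : \forall s \near t, cdom q (c s).
  exact: continuous_near cc (near_cdom (cdom_self q)).
have va : \forall s \near (t : R^o), velocity c s *m tin q (c s) = a s.
  apply: filterS (filterI hc cn) => s [[cs ss] qs].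
  by have [_] := velocity_chart cs ss qs.
have dy : differentiable y (t : R^o) by exact: smooth_near_differentiable.
have da : differentiable a (t : R^o).
  exact: smooth_near_differentiable (smooth_near_derive _ sc).
have dG : differentiable (gram g q) (y t) by exact: gram_differentiable.
have dGy := differentiable_comp dy dG.
have dI := differentiable_inner dGy da da.
have e : \forall s \near (t : R^o), inner ((gram g q \o y) s) (a s) (a s) =
    inner (g (c s)) (velocity c s) (velocity c s).
  apply: filterS (filterI va cn) => s [<- qs].
  by rewrite /= /y /= inner_gram.
have dE := derive_inner (1 : R^o) dGy da da.
have e1 : 'D_(1 : R^o) (gram g q \o y) (t : R^o) = 'D_(velocity c t) (gram g q) (chart q q).
  exact: derive_comp dy dG.
have e2 : 'D_(1 : R^o) (fun s : R^o => velocity c s *m tin q (c s)) (t : R^o) = 'D_(1 : R^o) a t.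
  exact: near_eq_derive va.
have e3 : cov_param g (c t) (c : R^o -> M) (velocity c) t 1 =
    'D_(1 : R^o) a t + christoffel_form g q (velocity c t) (velocity c t).
  by rewrite -e2.
have alg (b v : 'rV[R]_n) (A : 'M[R]_n) :
    inner A v v = inner (g q) (christoffel_form g q v v) v +
      inner (g q) v (christoffel_form g q v v) ->
    inner A v v + inner (g q) b v + inner (g q) v b =
    2 * inner (g q) (b + christoffel_form g q v v) v.
  move=> ->; rewrite innerDl (innerC v _ sg) (innerC v b sg); ring.
apply: near_eq_is_derive e _; rewrite e3.
rewrite -(alg _ _ _ (inner_derive_gram q (velocity c t) (velocity c t) (velocity c t))).
rewrite -e1.
have eG : (gram g q \o y) t = g q by exact: gram_self.
rewrite eG in dE; rewrite -dE; exact: derivableP (diff_derivable dI).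
Qed.

End Metric.

(** * Riemannian and slant maps *)

Section OrthogonalProjection.
Context {R : realType} {n : nat} (G : 'M[R]_n).
Hypothesis hG : inner_product G.
Implicit Types (u v w : 'rV[R]_n).

Lemma inner_ge0 v : 0 <= inner G v v.
Proof.
have [->|v0] := eqVneq v 0; first by rewrite inner0r.
by apply: ltW; case: hG => _; exact.
Qed.

Lemma oproj_uniq k (A : 'M[R]_(k, n)) u w : (u <= A)%MS -> perp G A (w - u) ->
  w *m oproj G A = u.
Proof.
move=> uA wu; have [pA pw] := oprojP A w hG.
apply/eqP; rewrite -subr_eq0; apply/negPn/negP => /(hG.2).
have sA : (w *m oproj G A - u <= A)%MS by rewrite addmx_sub // eqmx_opp.
have := wu _ sA; have := pw _ sA; rewrite !(innerDl, innerNl) => h1 h2.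
lra.
Qed.

Lemma oproj_id k (A : 'M[R]_(k, n)) u : (u <= A)%MS -> u *m oproj G A = u.
Proof. by move=> uA; apply: oproj_uniq => // w _; rewrite subrr inner0l. Qed.

Lemma eq_oproj k l (A : 'M[R]_(k, n)) (B : 'M[R]_(l, n)) :
  (A == B)%MS -> oproj G A = oproj G B.
Proof.
move=> /eqmxP AB; apply/row_matrixP => i; rewrite !rowE; apply: oproj_uniq.
  by rewrite AB; have [] := oprojP B (delta_mx 0 i) hG.
by move=> w; rewrite AB; have [_] := oprojP B (delta_mx 0 i) hG; apply.
Qed.

Lemma inner_oproj k (A : 'M[R]_(k, n)) w :
  inner G w w = inner G (w *m oproj G A) (w *m oproj G A) +
    inner G (w - w *m oproj G A) (w - w *m oproj G A).
Proof.
have [pA pw] := oprojP A w hG.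
have [sG _] := hG.
have := pw _ pA; have := innerC w (w *m oproj G A) sG.
rewrite !(innerDl, innerNl, innerDr, innerNr); lra.
Qed.

Lemma inner_oprojl k (A : 'M[R]_(k, n)) w u : (u <= A)%MS ->
  inner G (w *m oproj G A) u = inner G w u.
Proof.
move=> uA; have [_ /(_ _ uA)] := oprojP A w hG.
rewrite innerDl innerNl; lra.
Qed.

Variable J : 'M[R]_n.
Hypothesis J2 : J *m J = - 1%:M.
Hypothesis isoJ : forall u v, inner G (u *m J) (v *m J) = inner G u v.

(** [acos] inverts [cos] only on [-1, 1]. The quotient of norms lies there because J preserves
    lengths and an orthogonal projection does not increase them. *)
Lemma cos_angle_subspace k (A : 'M[R]_(k, n)) w : w != 0 ->
  inner G (w *m J *m oproj G A) (w *m J *m oproj G A) =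
  cos (angle_subspace G (w *m J) A) ^+ 2 * inner G w w.
Proof.
move=> w0; have ww : 0 < inner G w w by exact: hG.2.
have le1 : inner G (w *m J *m oproj G A) (w *m J *m oproj G A) <= inner G w w.
  by rewrite -[leRHS]isoJ [leRHS](inner_oproj A) lerDl inner_ge0.
rewrite /angle_subspace acosK.
  rewrite expr_div_n /gnorm !sqr_sqrtr ?inner_ge0 // isoJ divfK //.
  by rewrite gt_eqF.
rewrite in_itv /= /gnorm [X in _ / Num.sqrt X]isoJ; apply/andP; split.
  by rewrite (le_trans (lerN10 _)) // divr_ge0 // sqrtr_ge0.
by rewrite ler_pdivrMr ?sqrtr_gt0 // mul1r; exact: ler_wsqrtr.
Qed.

Lemma inner_skew u v : inner G (u *m J) v = - inner G u (v *m J).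
Proof.
rewrite -[in LHS](_ : - (v *m J *m J) = v); last by rewrite -mulmxA J2 mulmxN mulmx1 opprK.
by rewrite innerNr isoJ.
Qed.

(* The vertical part of J is skew, so its square is determined by its lengths. *)
Lemma oproj_slant k (A : 'M[R]_(k, n)) (a : R) :
  (forall w, (w <= A)%MS -> inner G (w *m J *m oproj G A) (w *m J *m oproj G A) =
     a * inner G w w) ->
  forall w, (w <= A)%MS -> w *m J *m oproj G A *m J *m oproj G A = - (a *: w).
Proof.
move=> h w wA; have [sG _] := hG.
(* Polarization: the assumption on lengths also determines the inner products. *)
have pol u v : (u <= A)%MS -> (v <= A)%MS ->
    inner G (u *m J *m oproj G A) (v *m J *m oproj G A) = a * inner G u v.
  move=> uA vA; have := h _ (addmx_sub uA vA); have := h _ uA; have := h _ vA.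
  rewrite !mulmxDl !(innerDl, innerDr) (innerC v u sG).
  rewrite (innerC (v *m J *m oproj G A) _ sG); lra.
apply/eqP; rewrite -subr_eq0 opprK; apply/negPn/negP => /(hG.2).
(* With T the vertical part of J and z = T (T w) + a w, skewness gives (z, z) = - (T w, T z) + a (w,
   z), which is 0 by [pol]. *)
set z := _ *m oproj G A + _.
have zA : (z <= A)%MS.
  by rewrite addmx_sub ?scalemx_sub //; have [] := oprojP A (w *m J *m oproj G A *m J) hG.
have pA v : (v *m oproj G A <= A)%MS by have [] := oprojP A v hG.
rewrite {1}/z innerDl inner_oprojl // inner_skew innerZl -(pol _ _ wA zA).
rewrite (innerC _ (z *m J *m oproj G A) sG) (inner_oprojl (z *m J)) //.
rewrite (innerC (z *m J) _ sG).
by rewrite addNr ltxx.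
Qed.

End OrthogonalProjection.

Lemma derive_schwarz_rV {R : realType} {E : normedModType R} n (h : E -> 'rV[R]_n) x u v :
  smooth_near x h -> 'D_u ('D_v h) x = 'D_v ('D_u h) x.
Proof.
move=> sh.
have entry (a b : E) j : ('D_a ('D_b h) x) 0 j = 'D_a ('D_b (fun y => h y 0 j)) x.
  have sb := smooth_near_derive b sh.
  rewrite (derive_entry a 0 j (smooth_near_differentiable sb)).
  apply: near_eq_derive; apply: filterS (smooth_near_nbhs sh) => y sy.
  exact: derive_entry (smooth_near_differentiable sy).
apply/rowP => j; apply: etrans (entry _ _ _) _; apply: etrans _ (esym (entry _ _ _)).
exact: derive_schwarz (smooth_near_entry _ _ sh).
Qed.

Lemma mulmx_cancel (R : realType) k l m n q (A : 'M[R]_(k, l)) (B : 'M[R]_(l, m))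
    (C : 'M[R]_(m, l)) (D : 'M[R]_(l, n)) (E : 'M[R]_(n, q)) :
  B *m C = 1%:M -> A *m B *m (C *m D *m E) = A *m D *m E.
Proof. by move=> BC; rewrite -!mulmxA (mulmxA B) BC mul1mx. Qed.

(** * Levi-Civita connections under a Riemannian map *)

Section RiemannianMap.
Context {R : realType} {m n : nat} {P : manifold R m} {Q : manifold R n}.
Variables (gP : P -> 'M[R]_m) (gQ : Q -> 'M[R]_n) (f : P -> Q).
Hypotheses (hP : riemannian_metric gP) (hQ : riemannian_metric gQ).
Hypothesis hf : riemannian_map gP gQ f.

(** It suffices that one of the two vectors is orthogonal to the kernel: the kernel part of the
    other contributes to neither side. *)
Lemma riemannian_map_inner p u v : perp (gP p) (kermx (tmap f p)) u ->
  inner (gQ (f p)) (u *m tmap f p) (v *m tmap f p) = inner (gP p) u v.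
Proof.
move=> pu; have [kv pv] := oprojP (kermx (tmap f p)) v (hP p).1.
rewrite -{1}[v](subrK (v *m oproj (gP p) (kermx (tmap f p)))) mulmxDl.
rewrite (sub_kermxP kv) addr0 hf.2 // innerDr innerNr.
by rewrite (pu _ kv) subr0.
Qed.

Lemma smooth_near_comp_chart p k l (h : 'rV[R]_n -> 'M[R]_(k, l)) :
  smooth_near (chart (f p) (f p)) h ->
  smooth_near (chart p p) (h \o local_rep f p (f p)).
Proof.
move=> sh; apply: smooth_near_comp_rV; first exact: (hf.1 p).2.
by rewrite /local_rep /= chartV_self.
Qed.

(** [inner_nabla] is used on both sides with e constant in the chart at p and df(e) constant in the
    chart at f p. The image of the constant e under df varies with the point, and the resulting
    correction is a second derivative of f. *)
Lemma inner_nabla_map (X : P -> 'rV[R]_m) (W : Q -> 'rV[R]_n) p e :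
  smooth_vfield X p -> (\forall r \near p, perp (gP r) (kermx (tmap f r)) (X r)) ->
  smooth_vfield W (f p) -> (\forall r \near p, X r *m tmap f r = W (f r)) ->
  inner (gQ (f p)) (nabla gQ W (f p) (W (f p))) (e *m tmap f p) =
  inner (gP p) (nabla gP X p (X p)) e.
Proof.
move=> sX pX sW XW; pose q := f p; pose F := local_rep f p q; pose x0 := chart p p.
have [cf sF] := hf.1 p.
pose J := jacobian F; pose GQ := gram gQ q; pose V := vrep q W.
have dF : differentiable F x0 by exact: smooth_near_differentiable.
have dJ : differentiable J x0.
  exact: smooth_near_differentiable (smooth_near_jacobian sF).
have Fx0 : F x0 = chart q q by rewrite /F /local_rep /= chartV_self.
have dGQ : differentiable GQ (F x0) by rewrite Fx0; exact: gram_differentiable.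
have dV : differentiable V (F x0) by rewrite Fx0; exact: smooth_near_differentiable.
have dX : differentiable (vrep p X) x0 by exact: smooth_near_differentiable.
have Jx0 : J x0 = tmap f p by [].
have XWp : X p *m tmap f p = W q := nbhs_singleton XW.
have DF v : 'D_v F x0 = v *m tmap f p by exact: deriveEjacobian.
(* In the two fixed charts, F pulls the covector of W back to that of X. It must hold for every v:
   the first term of [inner_nabla] uses v = e, the second uses v = X. *)
have nearJ : \forall x \near x0, V (F x) = vrep p X x *m J x /\
    forall v, inner (gram gP p x) (vrep p X x) v = inner (GQ (F x)) (V (F x)) (v *m J x).
  have cn : \forall r \near p, cdom q (f r).
    exact: continuous_near cf (near_cdom (cdom_self q)).
  have h0 : \forall r \near p, perp (gP r) (kermx (tmap f r)) (X r) /\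
      (X r *m tmap f r = W (f r) /\ cdom q (f r)).
    exact: filterI pX (filterI XW cn).
  have h1 := near_chart (cdom_self p) h0.
  apply: filterS2 (chartVK (cdom_self p)) h1 => x [px xE] [pXx [XWx qx]].
  have [_ Jcx] := local_rep_smooth hf.1 px qx; rewrite xE in Jcx.
  have Jx : J x = tout p (chartV p x) *m tmap f (chartV p x) *m tin q (f (chartV p x)).
    exact: Jcx.
  have VE : V (F x) = W (f (chartV p x)) *m tin q (f (chartV p x)).
    by rewrite /V /F /local_rep /vrep /= chartK.
  have XJ v : v *m tin p (chartV p x) *m J x =
      v *m tmap f (chartV p x) *m tin q (f (chartV p x)).
    by rewrite Jx; exact: mulmx_cancel (tin_tout px).
  split=> [|v]; first by rewrite VE -XWx -XJ.
  have [w ->] : exists w, v = w *m tin p (chartV p x).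
    exists (v *m tout p (chartV p x)); have := tout_tin px.
    by move: (tout _ _) (tin _ _) => A B AB; rewrite -mulmxA AB mulmx1.
  rewrite XJ VE -XWx.
  have eP := inner_gram gP (X (chartV p x)) w px; rewrite xE in eP.
  have eQ := inner_gram gQ (X (chartV p x) *m tmap f (chartV p x))
    (w *m tmap f (chartV p x)) qx.
  exact: etrans eP (etrans (esym (riemannian_map_inner w pXx)) (esym eQ)).
have nearV : \forall x \near x0, V (F x) = vrep p X x *m J x.
  by apply: filterS nearJ => x [].
have DV v : 'D_(v *m tmap f p) V (chart q q) =
    'D_v (vrep p X) x0 *m tmap f p + X p *m 'D_v J x0.
  apply: etrans (congr2 (fun a b => 'D_a V b) (esym (DF v)) (esym Fx0)) _.
  apply: etrans (esym (derive_comp v dF dV)) _.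
  apply: etrans (near_eq_derive v nearV) _.
  apply: etrans (derive_mulmx v dX dJ).2 _.
  have eX : vrep p X x0 = X p := vrep_self p X.
  by rewrite Jx0 eX.
have DJ u v : v *m 'D_u J x0 = 'D_u ('D_v F) x0.
  have dv : differentiable (fun=> v) x0 by exact: differentiable_cst.
  have [_ e0] := derive_mulmx u dv dJ; rewrite derive_cst mul0mx add0r in e0.
  apply: etrans (esym e0) _.
  apply: near_eq_derive; apply: filterS (smooth_near_nbhs sF) => x sx.
  exact: esym (deriveEjacobian _ (smooth_near_differentiable sx)).
have dcV := differentiable_comp dF dV; have dcG := differentiable_comp dF dGQ.
have dce : differentiable (fun=> e) x0 by exact: differentiable_cst.
have deJ : differentiable (fun x => e *m J x) x0 := (derive_mulmx 0 dce dJ).1.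
(* Compared with [A3], where df(e) is frozen, the last term is the effect of [e *m J x] moving with
   x. *)
have A1 : 'D_(X p) (fun x => inner (gram gP p x) (vrep p X x) e) x0 =
    inner ('D_(W q) GQ (chart q q)) (W q) (e *m tmap f p) +
    inner (gQ q) ('D_(W q) V (chart q q)) (e *m tmap f p) +
    inner (gQ q) (W q) ('D_(X p) (fun x => e *m J x) x0).
  have nearI : \forall x \near x0, inner (gram gP p x) (vrep p X x) e =
      inner ((GQ \o F) x) ((V \o F) x) (e *m J x).
    by apply: filterS nearJ => x [_]; exact.
  apply: etrans (near_eq_derive (X p) nearI) _.
  apply: etrans (derive_inner (X p) dcG dcV deJ) _.
  have eG : 'D_(X p) (GQ \o F) x0 = 'D_(W q) GQ (chart q q).
    apply: etrans (derive_comp (X p) dF dGQ) _.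
    have e1 : 'D_(X p) F x0 = W q := etrans (DF _) XWp.
    by rewrite Fx0 e1.
  have eV : 'D_(X p) (V \o F) x0 = 'D_(W q) V (chart q q).
    apply: etrans (derive_comp (X p) dF dV) _.
    have e1 : 'D_(X p) F x0 = W q := etrans (DF _) XWp.
    by rewrite Fx0 e1.
  have eG0 : (GQ \o F) x0 = gQ q := etrans (congr1 GQ Fx0) (gram_self gQ q).
  have eV0 : (V \o F) x0 = W q := etrans (congr1 V Fx0) (vrep_self q W).
  by rewrite eG eV eG0 eV0.
have A2 : 'D_e (fun x => inner (gram gP p x) (vrep p X x) (vrep p X x)) x0 =
    'D_(e *m tmap f p) (fun y => inner (GQ y) (V y) (V y)) (chart q q).
  have dI := differentiable_inner dGQ dV dV.
  have nearI : \forall x \near x0, inner (gram gP p x) (vrep p X x) (vrep p X x) =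
      ((fun y => inner (GQ y) (V y) (V y)) \o F) x.
    by apply: filterS nearJ => x [e1 /(_ (vrep p X x))]; rewrite -e1.
  apply: etrans (near_eq_derive e nearI) _.
  apply: etrans (derive_comp e dF dI) _.
  by rewrite Fx0 (DF e).
have A3 : 'D_(W q) (fun y => inner (GQ y) (V y) (e *m tmap f p)) (chart q q) =
    inner ('D_(W q) GQ (chart q q)) (W q) (e *m tmap f p) +
    inner (gQ q) ('D_(W q) V (chart q q)) (e *m tmap f p) + 0.
  have dc : differentiable (fun=> e *m tmap f p) (F x0) by exact: differentiable_cst.
  rewrite Fx0 in dc dGQ dV; apply: etrans (derive_inner (W q) dGQ dV dc) _.
  rewrite derive_cst inner0r.
  have eG0 : GQ (chart q q) = gQ q := gram_self gQ q.
  have eV0 : V (chart q q) = W q := vrep_self q W.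
  by rewrite eG0 eV0.
(* The same correction appears here, because X applied to the derivative of J along e equals e
   applied to that along X, by Schwarz. In the final combination the two corrections cancel. *)
have A4 : inner (gQ q) (W q) ('D_(e *m tmap f p) V (chart q q)) =
    inner (gP p) (X p) ('D_e (vrep p X) x0) +
    inner (gQ q) (W q) ('D_(X p) (fun x => e *m J x) x0).
  have eJ : 'D_(X p) (fun x => e *m J x) x0 = X p *m 'D_e J x0.
    have [_ e0] := derive_mulmx (X p) dce dJ; rewrite derive_cst mul0mx add0r in e0.
    apply: etrans e0 _; apply: etrans (DJ _ _) _; apply: etrans _ (esym (DJ _ _)).
    exact: derive_schwarz_rV.
  rewrite DV innerDr eJ; congr (_ + _).
  rewrite -XWp; exact: riemannian_map_inner (nbhs_singleton pX).
have two0 : (2 : R) != 0 by rewrite pnatr_eq0.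
apply: (mulfI two0).
apply: etrans (inner_nabla hQ (e *m tmap f p) sW) _.
apply: etrans _ (esym (inner_nabla hP e sX)).
have alg (a a' a1 a2 b b' c d h : R) : a = a1 + a2 + 0 -> a' = a1 + a2 + d ->
    b' = b -> h = c + d -> 2 * a - b + 2 * h = 2 * a' - b' + 2 * c.
  by move=> -> -> -> ->; ring.
exact: alg A3 A1 A2 A4.
Qed.

End RiemannianMap.

(** * The adjoint of the differential *)

Section Adjoint.
Context {R : realType} {m n : nat} {P : manifold R m} {Q : manifold R n}.
Variables (gP : P -> 'M[R]_m) (gQ : Q -> 'M[R]_n) (f : P -> Q).
Hypotheses (hP : riemannian_metric gP) (hQ : riemannian_metric gQ).
Hypothesis hf : riemannian_map gP gQ f.

Lemma adjoint_perp p (w : 'rV[R]_n) : perp (gP p) (kermx (tmap f p)) (w *m adjoint gP gQ f p).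
Proof.
move=> v /sub_kermxP vT0; have [sP _] := (hP p).1.
rewrite (innerC _ _ sP) -(adjointP v w (hP p).1 (hQ (f p)).1) vT0.
exact: inner0l.
Qed.

(** On vectors orthogonal to the kernel df is an isometry, so there its adjoint is its inverse. *)
Lemma tmap_adjoint p (u : 'rV[R]_m) : perp (gP p) (kermx (tmap f p)) u ->
  u *m tmap f p *m adjoint gP gQ f p = u.
Proof.
move=> pu; have [sP _] := (hP p).1; have [sQ _] := (hQ (f p)).1.
apply: (inner_inj (hP p).1) => v.
rewrite (innerC _ v sP) -(adjointP v (u *m tmap f p) (hP p).1 (hQ (f p)).1).
by rewrite (innerC _ (u *m tmap f p) sQ) (riemannian_map_inner hP hf).
Qed.

Lemma adjoint_tmap p (w : 'rV[R]_n) : (w <= tmap f p)%MS ->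
  w *m adjoint gP gQ f p *m tmap f p = w.
Proof.
move=> /submxP[u ->]; set u' := u - u *m oproj (gP p) (kermx (tmap f p)).
have [ku pu] := oprojP (kermx (tmap f p)) u (hP p).1.
have -> : u *m tmap f p = u' *m tmap f p by rewrite mulmxBl (sub_kermxP ku) subr0.
by rewrite tmap_adjoint.
Qed.

Lemma smooth_vfield_adjoint (W : Q -> 'rV[R]_n) p : smooth_vfield W (f p) ->
  smooth_vfield (fun r => W (f r) *m adjoint gP gQ f r) p.
Proof.
move=> sW; pose q := f p; pose F := local_rep f p q.
have [cf sF] := hf.1 p.
have uG : gram gP p (chart p p) \in unitmx.
  by rewrite gram_self; exact: inner_product_unitmx (hP p).1.
have := smooth_near_mulmx (smooth_near_mulmx (smooth_near_mulmx
    (smooth_near_comp_chart hf sW) (smooth_near_comp_chart hf (hQ q).2))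
    (smooth_near_trmx (smooth_near_jacobian sF))) (smooth_near_invmx uG (hP p).2).
apply: smooth_near_ext.
have cn : \forall r \near p, cdom q (f r).
  exact: continuous_near cf (near_cdom (cdom_self q)).
apply: filterS2 (chartVK (cdom_self p)) (near_chart (cdom_self p) cn) => x [px xE] qx.
have [_ Jx] := local_rep_smooth hf.1 px qx; rewrite xE in Jx.
(* Here A and A' are [tin] and [tout] on Q, B and B' those on P: the matrix formula of the adjoint,
   evaluated on coordinate expressions, is the adjoint itself followed by one change of chart on
   P. *)
have alg (w : 'rV[R]_n) (A A' G : 'M[R]_n) (B B' H : 'M[R]_m) (T : 'M[R]_(m, n)) :
    A *m A' = 1%:M -> B *m B' = 1%:M -> B' *m B = 1%:M -> H \in unitmx ->
    w *m A *m (A' *m G *m A'^T) *m (B' *m T *m A)^T *m invmx (B' *m H *m B'^T) =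
    w *m (G *m T^T *m invmx H) *m B.
  move=> AA BB B'B uH.
  have -> : invmx (B' *m H *m B'^T) = B^T *m invmx H *m B.
    have BTB : B'^T *m B^T = 1%:M by rewrite -trmx_mul BB trmx1.
    have e : (B' *m H *m B'^T) *m (B^T *m invmx H *m B) = 1%:M.
      by rewrite -!mulmxA (mulmxA B'^T) BTB mul1mx (mulmxA H) mulmxV // mul1mx.
    have [u1 _] := mulmx1_unit e.
    by rewrite -[RHS](mulKmx u1) e mulmx1.
  have BTB : B'^T *m B^T = 1%:M by rewrite -trmx_mul BB trmx1.
  have ATA : A'^T *m A^T = 1%:M by rewrite -trmx_mul AA trmx1.
  rewrite !trmx_mul -!mulmxA (mulmxA A A') AA mul1mx (mulmxA A'^T) ATA mul1mx.
  by rewrite (mulmxA B'^T) BTB mul1mx.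
have e := alg (W (f (chartV p x))) _ _ (gQ (f (chartV p x))) _ _ (gP (chartV p x))
  (tmap f (chartV p x)) (tin_tout qx) (tin_tout px) (tout_tin px)
  (inner_product_unitmx (hP _).1).
have e1 : (vrep q W \o F) x = W (f (chartV p x)) *m tin q (f (chartV p x)).
  by rewrite /F /local_rep /vrep /= chartK.
have e2 : (gram gQ q \o F) x = tout q (f (chartV p x)) *m gQ (f (chartV p x)) *m
    (tout q (f (chartV p x)))^T.
  by rewrite /F /local_rep /gram /= chartK.
have cg (a a' : 'rV[R]_n) (A A' : 'M[R]_n) (C C' : 'M[R]_(m, n)) (H : 'M[R]_m) :
    a = a' -> A = A' -> C = C' ->
    a *m A *m C^T *m invmx H = a' *m A' *m C'^T *m invmx H by move=> -> -> ->.
exact: etrans (cg _ _ _ _ _ _ (gram gP p x) e1 e2 Jx) e.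
Qed.

End Adjoint.

(** * Velocity sections *)

Section Curves.
Context {R : realType}.

Lemma near_derive0_cst (s : R -> R) (t : R) :
  (\forall r \near t, is_derive (r : R^o) (1 : R^o) (s : R^o -> R^o) 0) ->
  \forall r \near t, s r = s t.
Proof.
move=> /nbhs_ballP[e /= e0 ds]; near=> r.
have er : ball t e r by near: r; exact: nbhsx_ballx.
have cst a b : a < b -> ball t e a -> ball t e b -> s a = s b.
  move=> ab ea eb; have sub z : z \in `[a, b] -> ball t e z.
    rewrite in_itv /= => /andP[az zb]; move: ea eb.
    rewrite -!ball_normE /ball_ /= !ltr_distlC => /andP[h1 _] /andP[_ h2].
    by rewrite (lt_le_trans h1 az) (le_lt_trans zb h2).
  have [||z _] := @MVT R s (fun=> 0) a b ab.
  - by move=> z zab; apply/ds/sub; exact: subset_itv_oo_cc zab.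
  - by apply: derivable_within_continuous => z /sub/ds; case.
  by rewrite mul0r => /eqP; rewrite subr_eq0 => /eqP.
have et : ball t e t by exact: ballxx.
have [lt|lt|-> //] := ltgtP r t; first exact: cst.
exact/esym/cst.
Unshelve. all: by end_near. Qed.

Lemma cov_param_near0 n (M : manifold R n) (g : M -> 'M[R]_n) (c : R -> M)
    (V : R -> 'rV[R]_n) t : (\forall s \near t, V s = 0) ->
  cov_param g (c t) (c : R^o -> M) V t 1 = 0.
Proof.
move=> V0; have Vt : V t = 0 := nbhs_singleton V0.
rewrite /cov_param -/(christoffel_form _ _ _ _) Vt christoffel_form0r addr0.
apply: etrans (derive_cst (0 : 'rV[R]_n) (t : R^o) (1 : R^o)).
by apply: near_eq_derive; apply: filterS V0 => s ->; rewrite mul0mx.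
Qed.

Context {m n : nat} {P : manifold R m} {Q : manifold R n}.

Lemma velocity_map (f : P -> Q) (b : R -> P) s : smooth_map f ->
  {for s, continuous b} ->
  smooth_near (s : R^o) (chart (b s) \o b : R^o -> 'rV[R]_m) ->
  [/\ {for s, continuous (f \o b)},
      smooth_near (s : R^o) (chart (f (b s)) \o (f \o b) : R^o -> 'rV[R]_n) &
      velocity (f \o b) s = velocity b s *m tmap f (b s)].
Proof.
move=> sf cb sb; have [cf sF] := sf (b s).
have sFb := smooth_near_comp_rV sb sF.
have e : \forall r \near (s : R^o), ((chart (f (b s)) \o f \o chartV (b s)) \o
    (chart (b s) \o b : R^o -> 'rV[R]_m)) r = (chart (f (b s)) \o (f \o b)) r.
  have cn : \forall r \near s, cdom (b s) (b r).
    exact: continuous_near cb (near_cdom (cdom_self (b s))).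
  by apply: filterS cn => r br /=; rewrite chartK.
split; first exact: continuous_comp cb cf.
  exact: smooth_near_ext sFb.
apply: etrans (esym (near_eq_derive _ e)) _.
apply: etrans (derive_comp _ (smooth_near_differentiable sb)
  (smooth_near_differentiable sF)) _.
exact: deriveEjacobian (smooth_near_differentiable sF).
Qed.

End Curves.

Section VelocitySections.
Context {R : realType} {m n : nat} {P : manifold R m} {Q : manifold R n}.
Variables (gP : P -> 'M[R]_m) (gQ : Q -> 'M[R]_n) (f : P -> Q).
Hypotheses (hP : riemannian_metric gP) (hQ : riemannian_metric gQ).
Hypothesis hf : riemannian_map gP gQ f.
Variables (D : Q -> 'M[R]_n) (b : R -> P) (t : R).
Hypothesis hD : range_distribution gQ f (b t) D.
Hypothesis hb : \forall s \near t, {for s, continuous b} /\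
  smooth_near (s : R^o) (chart (b s) \o b : R^o -> 'rV[R]_m).

Lemma near_map_velocity : \forall s \near t,
  [/\ {for s, continuous (f \o b)},
      smooth_near (s : R^o) (chart (f (b s)) \o (f \o b) : R^o -> 'rV[R]_n) &
      (velocity (f \o b) s <= D (f (b s)))%MS].
Proof.
have [cb _] := nbhs_singleton hb.
have bD : \forall s \near t, (D (f (b s)) == tmap f (b s))%MS.
  exact: continuous_near cb hD.1.
apply: filterS2 hb bD => s [cs ss] /eqmxP Ds.
have [cfb sfb v] := velocity_map hf.1 cs ss.
by split=> //; rewrite Ds v submxMl.
Qed.

(* A curve with nonzero velocity at t is, near t, a graph over one of the
   coordinates, which gives the parameter as a smooth function on Q. *)
Lemma velocity_sections_exist : velocity (f \o b) t != 0 ->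
  exists X W U, velocity_sections gP gQ f D b t X W U.
Proof.
move=> v0; pose q := f (b t); pose c := f \o b.
have [cb sb] := nbhs_singleton hb.
have [cc sc vD] := nbhs_singleton near_map_velocity.
pose y := (chart q \o c : R^o -> 'rV[R]_n).
pose a : R^o -> 'rV[R]_n := 'D_(1 : R^o) y.
have at0 : a t = velocity c t by [].
have [j vj] : exists j, velocity c t 0 j != 0.
  apply/existsP; apply: contraNT v0; rewrite negb_exists => /forallP h.
  by apply/eqP/rowP => j; rewrite mxE; apply/eqP; have := h j; rewrite negbK.
have sy : smooth_near (t : R^o) y by [].
have syj := smooth_near_entry 0 j sy.
have Dyj : 'D_1 (fun s : R^o => y s 0 j) t != 0.
  have := derive_entry (1 : R^o) 0 j (smooth_near_differentiable sy).
  by move=> <-.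
have [s ss sK] := smooth_local_inverse syj Dyj.
have st : s (y t 0 j) = t := nbhs_singleton sK.
have sa : smooth_near (t : R^o) a by exact: smooth_near_derive.
have sas : smooth_near (y t 0 j) (a \o s).
  by apply: smooth_near_comp_R => //; rewrite st.
have saj : smooth_near (y t) ((a \o s) \o (fun x : 'rV[R]_n => x 0 j)).
  apply: smooth_near_comp_R => //; apply: smooth_near_entry.
  exact: smooth_near_id.
(* The velocity extended off the curve: a point of Q with j-th coordinate x_j receives the velocity
   at parameter s(x_j), read in the chart at that point. On the curve s recovers the parameter. *)
pose W0 r := a (s (chart q r 0 j)) *m tout q r.
have sW0 : smooth_vfield W0 q.
  have := saj; apply: smooth_near_ext.
  apply: filterS (chartVK (cdom_self q)) => x [qx xE].
  rewrite /W0 /= xE; have := tout_tin qx.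
  by move: (tout q (chartV q x)) (tin q (chartV q x)) => A B AB; rewrite -mulmxA AB mulmx1.
(* Off the curve [W0] need not be vertical; projecting repairs this and leaves the values on the
   curve unchanged, since the velocity lies in the range. *)
pose W := fun r => vert gQ D r (W0 r).
have sW : smooth_vfield W q by exact: smooth_vfield_endo hD.2.
have WD r : (W r <= D r)%MS by have [] := oprojP (D r) (W0 r) (hQ r).1.
have Wc : \forall r \near t, W (f (b r)) = vert gQ D (f (b r)) (velocity (f \o b) r).
  have cn : \forall r \near t, cdom q (c r).
    exact: continuous_near cc (near_cdom (cdom_self q)).
  apply: filterS2 near_map_velocity (filterI cn sK) => r [cr sr _] [qr srK].
  have [_ vr] := velocity_chart cr sr qr.
  have e : W0 (c r) = velocity c r.
    rewrite /W0 [s _]srK [a r]vr; have := tin_tout qr.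
    by move: (tin q (c r)) (tout q (c r)) => A B AB; rewrite -mulmxA AB mulmx1.
  by rewrite /W [W0 _]e.
(* The adjoint inverts df on the range, so it supplies the horizontal lift of W; U = 0 is right
   because the velocity has no normal part. *)
exists (fun r => W (f r) *m adjoint gP gQ f r), W, (fun=> 0); split.
- split; first exact: smooth_vfield_adjoint.
  by near=> r; exact: adjoint_perp.
- by split=> //; near=> r; exact: WD.
- split.
    have := smooth_near_cst (chart q q) (0 : 'rV[R]_n).
    by apply: smooth_near_ext; near=> x; rewrite mul0mx.
  by near=> r; move=> w _; rewrite inner0l.
- apply: filterS hD.1 => r /eqmxP Dr; apply: adjoint_tmap => //.
  by rewrite -Dr.
- apply: filterS2 Wc near_map_velocity => r Wr [_ _ vr]; split=> //.
  by rewrite /hor /vert oproj_id ?subrr //; case: (hQ (f (b r))).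
Unshelve. all: by end_near. Qed.

End VelocitySections.

(** * The geodesic equations *)

Section GeodesicEquations.
Context {R : realType} {m n : nat} {P : manifold R m} {Q : manifold R n}.
Variables (gP : P -> 'M[R]_m) (gQ J : Q -> 'M[R]_n) (f : P -> Q) (theta : R).
Hypotheses (hP : riemannian_metric gP) (hQ : kaehler gQ J).
Hypothesis hf : riemannian_map gP gQ f.
Variables (D : P -> Q -> 'M[R]_n) (b : R -> P) (t : R).
Hypothesis hD : range_distribution gQ f (b t) (D (b t)).

(** The pair of equations at one parameter t, isolated so that both directions of the theorem rest
    on one pointwise equivalence. *)
Definition geodesic_equations (X : P -> 'rV[R]_m) (W U : Q -> 'rV[R]_n) : Prop :=
    let p := b t in
    let q := f p in
    let c2 := cos theta ^+ 2 in
    let al := alpha gQ J (D p) in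
    let de := delta gQ J (D p) in
    let B := Bmap gQ J (D p) in
    let C := Cmap gQ J (D p) in
    let dalW := fun r : Q => de r (al r (W r)) in
    let BdW := fun r : Q => B r (de r (W r)) in
    let CdW := fun r : Q => C r (de r (W r)) in
    let BU := fun r : Q => B r (U r) in
    let CU := fun r : Q => C r (U r) in
    let adj := fun (V : Q -> 'rV[R]_n) (p' : P) =>
      V (f p') *m adjoint gP gQ f p' in
    let push := fun v : 'rV[R]_m => v *m tmap f p in
    let nablaX := fun Y : P -> 'rV[R]_m => nabla gP Y p (X p) in
    let nablaU := fun V : Q -> 'rV[R]_n => nabla gQ V q (U q) in
    let sff := fun Y : P -> 'rV[R]_m => second_fundamental_form gP gQ f X Y p in
    let S := fun V : Q -> 'rV[R]_n => weingarten gQ (D p) f (V \o f) X p in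
    let nX := fun V : Q -> 'rV[R]_n => nperp gQ (D p) f (V \o f) X p in
    let nU := fun V : Q -> 'rV[R]_n => nperpU gQ (D p) V U q in
    c2 *: push (nablaX X) + S dalW - push (nablaX (adj BdW)) + S CdW
      + c2 *: nablaU W - nablaU BdW
      - B q (sff (adj BU)) - al q (push (nablaX (adj BU))) + al q (S CU)
      - B q (nX CU) - al q (nablaU BU) - B q (nU CU) = 0 /\
    c2 *: sff X - nX dalW - sff (adj BdW) - nX CdW - nU dalW - nU CdW
      - C q (sff (adj BU)) - de q (push (nablaX (adj BU))) - de q (nablaU BU)
      - C q (nU CU) - C q (nX CU) + de q (S CU) = 0.

Lemma metricQ : riemannian_metric gQ.
Proof. by case: hQ. Qed.

Lemma smooth_vfield_vert (V : Q -> 'rV[R]_n) : smooth_vfield V (f (b t)) ->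
  smooth_vfield (fun r => vert gQ (D (b t)) r (V r *m J r)) (f (b t)).
Proof.
move=> sV; have [_ sJ _ _ _] := hQ.
exact: smooth_vfield_endo (smooth_vfield_endo sV (sJ _)) hD.2.
Qed.

Lemma smooth_vfield_hor (V : Q -> 'rV[R]_n) : smooth_vfield V (f (b t)) ->
  smooth_vfield (fun r => hor gQ (D (b t)) r (V r *m J r)) (f (b t)).
Proof.
move=> sV; have [_ sJ _ _ _] := hQ.
apply: smooth_vfieldD; first exact: smooth_vfield_endo.
exact: smooth_vfieldN (smooth_vfield_vert sV).
Qed.

Hypothesis hs : slant gP gQ J f theta.

(** The slant condition speaks of vectors orthogonal to the kernel; a vector w of the range is
    reached through its lift by the adjoint, nonzero when w is. The identity is needed at all nearby
    points because it will be differentiated. *)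
Lemma near_slant : \forall r \near b t, forall w : 'rV[R]_n, (w <= D (b t) (f r))%MS ->
  w *m J (f r) *m oproj (gQ (f r)) (D (b t) (f r)) *m J (f r) *m
    oproj (gQ (f r)) (D (b t) (f r)) = - (cos theta ^+ 2 *: w).
Proof.
have [_ _ J2 isoJ _] := hQ.
apply: filterS hD.1 => r Dr; have hG := (metricQ (f r)).1.
rewrite (eq_oproj hG Dr) => w; rewrite (eqmxP Dr) => wT.
apply: (oproj_slant hG (J2 (f r)) (isoJ (f r))) wT => {}w wT.
have [->|w0] := eqVneq w 0; first by rewrite !mul0mx inner0r mulr0.
rewrite (cos_angle_subspace hG (isoJ (f r)) _ w0).
have wE := adjoint_tmap hP metricQ hf wT.
have X0 : w *m adjoint gP gQ f r != 0.
  by apply: contraNneq w0 => e; rewrite -wE e mul0mx.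
by rewrite -(hs (adjoint_perp hP metricQ w) X0) wE.
Qed.

Hypothesis hb : \forall s \near t, {for s, continuous b} /\
  smooth_near (s : R^o) (chart (b s) \o b : R^o -> 'rV[R]_m).

(** Whatever the sections, the two left sides equal [a] = df(nabla_X X) and [s] = (nabla df)(X, X),
    and the covariant acceleration is s + a. *)
Lemma geodesic_equationsP X W U :
  velocity_sections gP gQ f (D (b t)) b t X W U ->
  geodesic_equations X W U <->
  cov_param gQ (f (b t)) (f \o b : R^o -> Q) (velocity (f \o b)) t 1 = 0.
Proof.
move=> [[sX pX] [sW WD] [sU UD] XW Wc].
have [cb sb] := nbhs_singleton hb.
have [cfb sfb _] := nbhs_singleton (near_map_velocity hf hD hb).
set p := b t in sX pX XW cb sb *; set q := f p.
have Wv : \forall s \near t, velocity (f \o b) s = W ((f \o b) s) /\ U ((f \o b) s) = 0.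
  apply: filterS2 Wc (near_map_velocity hf hD hb) => s [Ws Us] [_ _ vD].
  have e : vert gQ (D p) (f (b s)) (velocity (f \o b) s) = velocity (f \o b) s.
    exact: (oproj_id (metricQ (f (b s))).1 vD).
  by rewrite [W _]Ws [U _]Us /hor e subrr.
have Wq : velocity (f \o b) t = W q by case: (nbhs_singleton Wv).
have Uq : U q = 0 by case: (nbhs_singleton Wv).
have XWp : X p *m tmap f p = W q := nbhs_singleton XW.
have covW : cov_param gQ q (f \o b : R^o -> Q) (velocity (f \o b)) t 1 = nabla gQ W q (W q).
  have VW : \forall s \near t, velocity (f \o b) s = W ((f \o b) s).
    by apply: filterS Wv => s [].
  by apply: etrans (cov_curve gQ cfb sfb sW VW) _; rewrite Wq.
have Z V : smooth_vfield V q -> (\forall s \near t, V ((f \o b) s) = 0) ->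
    nabla gQ V q (W q) = 0.
  by move=> sV V0; rewrite -Wq; exact: nabla_velocity0.
have nablaf V : smooth_vfield V q -> cov gQ f (V \o f) p (X p) = nabla gQ V q (W q).
  by move=> sV; rewrite (cov_comp gQ (X p) hf.1 sV) XWp.
have nU0 V : nabla gQ V q (U q) = 0 by rewrite Uq nabla0.
have nearU V : (forall r, U r = 0 -> V r = 0) -> \forall s \near t, V ((f \o b) s) = 0.
  by move=> h; apply: filterS Wv => s [_ /h].
have nV0 r : vert gQ (D p) r (0 *m J r) = 0 by rewrite /vert !mul0mx.
have nH0 r : hor gQ (D p) r (0 *m J r) = 0 by rewrite /hor nV0 mul0mx subrr.
rewrite /geodesic_equations -/p -/q.
(* [alpha] and [Bmap] have the same body, as do [delta] and [Cmap], so [al] and [de] stand for all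
   four. *)
pose al := fun r (w : 'rV[R]_n) => vert gQ (D p) r (w *m J r).
pose de := fun r (w : 'rV[R]_n) => hor gQ (D p) r (w *m J r).
pose BU := fun r => al r (U r); pose CU := fun r => de r (U r).
pose BdW := fun r => al r (de r (W r)); pose CdW := fun r => de r (de r (W r)).
pose dalW := fun r => de r (al r (W r)).
have sBU : smooth_vfield BU q by exact: smooth_vfield_vert.
have sCU : smooth_vfield CU q by exact: smooth_vfield_hor.
have sdalW : smooth_vfield dalW q by exact/smooth_vfield_hor/smooth_vfield_vert.
have sCdW : smooth_vfield CdW q by exact/smooth_vfield_hor/smooth_vfield_hor.
have nBU : nabla gQ BU q (W q) = 0.
  by apply: Z sBU _; apply: nearU => r Ur; rewrite /BU Ur; exact: nV0.
have nCU : nabla gQ CU q (W q) = 0.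
  by apply: Z sCU _; apply: nearU => r Ur; rewrite /CU Ur; exact: nH0.
have [_ _ J2 _ _] := hQ.
have WDf : \forall r \near p, (W (f r) <= D p (f r))%MS.
  exact: continuous_near (hf.1 p).1 WD.
have zm (a1 a2 a3 : 'rV[R]_n) : a1 - a2 + (a3 - a1 - (a3 - a2)) = 0.
  by rewrite opprB [a2 - a3]addrC [a3 - a1 + _]addrACA subrr add0r addrACA subrr addNr addr0.
(* The normal part of J (J W) = - W, whose right side is vertical. *)
have dC : \forall r \near p, dalW (f r) + CdW (f r) = 0.
  apply: filterS WDf => r WDr; have WO := oproj_id (metricQ (f r)).1 WDr.
  rewrite /dalW /CdW /de /al /hor /vert.
  move: (oproj _ _) WO => O WO; move: (J (f r)) (J2 (f r)) => Jr Jr2.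
  rewrite !mulmxBl -[W (f r) *m Jr *m Jr]mulmxA Jr2 mulmxN mulmx1 mulNmx WO.
  exact: zm.
(* The vertical part of J (J W) = - W reads alpha (alpha W) + B (delta W) = - W, and the first term
   is known from [near_slant]. *)
have Bd : \forall r \near p, BdW (f r) = (cos theta ^+ 2 - 1) *: W (f r).
  apply: filterS2 WDf near_slant => r WDr /(_ _ WDr) slr.
  have WO := oproj_id (metricQ (f r)).1 WDr.
  rewrite /BdW /de /al /hor /vert mulmxBl [LHS]mulmxBl slr.
  rewrite -[W (f r) *m J (f r) *m J (f r)]mulmxA J2 mulmxN mulmx1 mulNmx WO.
  by rewrite opprK scalerBl scale1r addrC.
have ndC : nabla gQ dalW q (W q) + nabla gQ CdW q (W q) = 0.
  rewrite -(nablaD gQ _ sdalW sCdW); apply: Z; first exact: smooth_vfieldD.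
  exact: continuous_near cb dC.
pose adj := fun (V : Q -> 'rV[R]_n) (r : P) => V (f r) *m adjoint gP gQ f r.
have adjBd : \forall r \near p, adj BdW r = (cos theta ^+ 2 - 1) *: X r.
  apply: filterS2 Bd (filterI XW pX) => r Br [Wr pXr].
  by rewrite /adj Br -scalemxAl -Wr (tmap_adjoint hP metricQ hf pXr).
have adjBU : \forall r \near p, adj BU r *m tmap f r = (BU \o f) r.
  apply: filterS hD.1 => r /eqmxP Dr; apply: (adjoint_tmap hP metricQ hf).
  by rewrite -Dr; have [] := oprojP (D p (f r)) (U (f r) *m J (f r)) (metricQ (f r)).1.
pose nX := nabla gP X p (X p).
(* The factor leaves the derivative because theta is the same at every point. *)
have n1 : nabla gP (adj BdW) p (X p) = (cos theta ^+ 2 - 1) *: nX.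
  by rewrite -(nablaZ gP _ _ sX); apply: near_eq_cov; exact: adjBd.
have s1 : second_fundamental_form gP gQ f X X p = nabla gQ W q (W q) - nX *m tmap f p.
  by rewrite /second_fundamental_form -(nablaf _ sW); congr (_ - _); exact: near_eq_cov.
have s2 : second_fundamental_form gP gQ f X (adj BdW) p =
    (cos theta ^+ 2 - 1) *: second_fundamental_form gP gQ f X X p.
  rewrite s1 /second_fundamental_form n1 scalerBr -scalemxAl; congr (_ - _).
  pose V r := (cos theta ^+ 2 - 1) *: W r.
  have sV : smooth_vfield V q by exact: smooth_vfieldZ.
  rewrite -(nablaZ gQ _ _ sW) -(nablaf V sV).
  apply: near_eq_cov; apply: filterS2 adjBd XW => r -> Wr.
  by rewrite -scalemxAl Wr.
(* BU vanishes along the curve, so the derivative of its pullback along X is 0. What remains cancels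
   the terms in [k]: B (- k) + alpha k = 0, and likewise for C and delta. *)
have s3 : second_fundamental_form gP gQ f X (adj BU) p =
    - (nabla gP (adj BU) p (X p) *m tmap f p).
  rewrite /second_fundamental_form (near_eq_cov gQ f (X p) adjBU) (nablaf _ sBU) nBU.
  exact: sub0r.
set k := nabla gP (adj BU) p (X p) *m tmap f p in s3.
pose a := nX *m tmap f p; pose s := second_fundamental_form gP gQ f X X p.
have vN w : vert gQ (D p) q (- w) = - vert gQ (D p) q w by exact: mulNmx.
have v0 : vert gQ (D p) q 0 = 0 by exact: mul0mx.
have hN w : hor gQ (D p) q (- w) = - hor gQ (D p) q w by rewrite /hor vN opprD.
have h0 : hor gQ (D p) q 0 = 0 by rewrite /hor v0 subrr.
have alN w : al q (- w) = - al q w by rewrite /al mulNmx vN.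
have deN w : de q (- w) = - de q w by rewrite /de mulNmx hN.
have al0 : al q 0 = 0 by exact: nV0.
have de0 : de q 0 = 0 by exact: nH0.
have NdE : nabla gQ CdW q (W q) = - nabla gQ dalW q (W q).
  by apply/eqP; rewrite -addr_eq0 addrC ndC.
have zc (x y v w : 'rV[R]_n) : x - v - (x - y) + v + w - w = y.
  by rewrite addrK addrAC subrK opprB addrC subrK.
have cE (y : 'rV[R]_n) : (cos theta ^+ 2 - 1) *: y = cos theta ^+ 2 *: y - y.
  by rewrite scalerBl scale1r.
(* The Weingarten terms of dalW and CdW are opposite by [NdE], the terms with U vanish or cancel,
   and cos^2 theta a - (cos^2 theta - 1) a = a remains. *)
have eq1 : cos theta ^+ 2 *: a
    + - vert gQ (D p) q (cov gQ f (dalW \o f) p (X p))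
    - nabla gP (adj BdW) p (X p) *m tmap f p
    + - vert gQ (D p) q (cov gQ f (CdW \o f) p (X p))
    + cos theta ^+ 2 *: nabla gQ W q (U q) - nabla gQ BdW q (U q)
    - al q (second_fundamental_form gP gQ f X (adj BU) p) - al q k
    + al q (- vert gQ (D p) q (cov gQ f (CU \o f) p (X p)))
    - al q (hor gQ (D p) q (cov gQ f (CU \o f) p (X p)))
    - al q (nabla gQ BU q (U q)) - al q (hor gQ (D p) q (nabla gQ CU q (U q))) = a.
  rewrite !nablaf // !nU0 nCU n1 s3 NdE v0 h0 al0 oppr0 al0 !vN alN !opprK.
  rewrite scaler0 !(subr0, addr0) -scalemxAl -/a cE; exact: zc.
(* The same cancellations in the normal part: cos^2 theta s - (cos^2 theta - 1) s = s. *)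
have eq2 : cos theta ^+ 2 *: s
    - hor gQ (D p) q (cov gQ f (dalW \o f) p (X p))
    - second_fundamental_form gP gQ f X (adj BdW) p
    - hor gQ (D p) q (cov gQ f (CdW \o f) p (X p))
    - hor gQ (D p) q (nabla gQ dalW q (U q)) - hor gQ (D p) q (nabla gQ CdW q (U q))
    - de q (second_fundamental_form gP gQ f X (adj BU) p) - de q k
    - de q (nabla gQ BU q (U q)) - de q (hor gQ (D p) q (nabla gQ CU q (U q)))
    - de q (hor gQ (D p) q (cov gQ f (CU \o f) p (X p)))
    + de q (- vert gQ (D p) q (cov gQ f (CU \o f) p (X p))) = s.
  rewrite !nablaf // !nU0 nCU s2 s3 NdE v0 h0 de0 oppr0 de0 !hN deN !opprK.
  rewrite !(subr0, addr0) -/s cE; exact: zc.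
apply: (@iff_trans _ (a = 0 /\ s = 0)).
  by split=> [[h1 h2]|[a0 s0]]; split; [exact: etrans (esym eq1) h1|
    exact: etrans (esym eq2) h2|exact: etrans eq1 a0|exact: etrans eq2 s0].
have NE : nabla gQ W q (W q) = s + a by rewrite /s s1 subrK.
rewrite covW; split=> [[a0 s0]|N0]; first by rewrite NE a0 s0 addr0.
(* Testing against every e, kernel directions included, gives nabla_X X = 0 itself and not just the
   vanishing of its image. *)
have nX0 : nX = 0.
  apply: (inner_inj (hP p).1) => e.
  rewrite -(inner_nabla_map hP metricQ hf e sX pX sW XW) -/q N0.
  by rewrite !inner0l.
have a0 : a = 0 by rewrite /a nX0 mul0mx.
by split=> //; rewrite -N0 NE a0 addr0.
Qed.

End GeodesicEquations.

Theorem theorem3p1 (R : realType) (m n : nat)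
    (P : manifold R m) (Q : manifold R n)
    (gP : P -> 'M[R]_m) (gQ J : Q -> 'M[R]_n)
    (f : P -> Q) (theta : R) (D : P -> Q -> 'M[R]_n)
    (I : set R) (b : R -> P)
    (gP_metric : riemannian_metric gP)
    (Q_kaehler : kaehler gQ J)
    (f_riemannian : riemannian_map gP gQ f)
    (f_slant : slant gP gQ J f theta)
    (range_perp_neq0 : forall p : P,
       exists2 V : 'rV[R]_n, V != 0 & perp (gQ (f p)) (tmap f p) V)
    (range_D : forall p : P, range_distribution gQ f p (D p))
    (range_perp_tg : forall p : P, perp_totally_geodesic gQ (D p) (f p))
    (I_open : open I) (I_interval : is_interval I)
    (b_geodesic : geodesic gP I b) :
  geodesic gQ I (f \o b) <->
  forall (t : R) (X : P -> 'rV[R]_m) (W U : Q -> 'rV[R]_n), I t ->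
    velocity_sections gP gQ f (D (b t)) b t X W U ->
    let p := b t in
    let q := f p in
    let c2 := cos theta ^+ 2 in
    let al := alpha gQ J (D p) in
    let de := delta gQ J (D p) in
    let B := Bmap gQ J (D p) in
    let C := Cmap gQ J (D p) in
    let dalW := fun r : Q => de r (al r (W r)) in
    let BdW := fun r : Q => B r (de r (W r)) in
    let CdW := fun r : Q => C r (de r (W r)) in
    let BU := fun r : Q => B r (U r) in
    let CU := fun r : Q => C r (U r) in
    let adj := fun (V : Q -> 'rV[R]_n) (p' : P) =>
      V (f p') *m adjoint gP gQ f p' in
    let push := fun v : 'rV[R]_m => v *m tmap f p in
    let nablaX := fun Y : P -> 'rV[R]_m => nabla gP Y p (X p) in
    let nablaU := fun V : Q -> 'rV[R]_n => nabla gQ V q (U q) in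
    let sff := fun Y : P -> 'rV[R]_m => second_fundamental_form gP gQ f X Y p in
    let S := fun V : Q -> 'rV[R]_n => weingarten gQ (D p) f (V \o f) X p in
    let nX := fun V : Q -> 'rV[R]_n => nperp gQ (D p) f (V \o f) X p in
    let nU := fun V : Q -> 'rV[R]_n => nperpU gQ (D p) V U q in
    c2 *: push (nablaX X) + S dalW - push (nablaX (adj BdW)) + S CdW
      + c2 *: nablaU W - nablaU BdW
      - B q (sff (adj BU)) - al q (push (nablaX (adj BU))) + al q (S CU)
      - B q (nX CU) - al q (nablaU BU) - B q (nU CU) = 0 /\
    c2 *: sff X - nX dalW - sff (adj BdW) - nX CdW - nU dalW - nU CdW
      - C q (sff (adj BU)) - de q (push (nablaX (adj BU))) - de q (nablaU BU)
      - C q (nU CU) - C q (nX CU) + de q (S CU) = 0.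
Proof.
have hQ : riemannian_metric gQ by case: Q_kaehler.
have near_I t : I t -> \forall s \near t, I s by move=> It; exact: open_nbhs_nbhs.
have hb t : I t -> \forall s \near t, {for s, continuous b} /\
    smooth_near (s : R^o) (chart (b s) \o b : R^o -> 'rV[R]_m).
  by move=> It; apply: filterS (near_I t It) => s /b_geodesic[].
have eqsP t X W U : I t -> velocity_sections gP gQ f (D (b t)) b t X W U ->
    geodesic_equations gP gQ J f theta D b t X W U <->
    cov_param gQ (f (b t)) (f \o b : R^o -> Q) (velocity (f \o b)) t 1 = 0.
  move=> It; exact: (geodesic_equationsP gP_metric Q_kaehler f_riemannian
    (range_D (b t)) f_slant (hb t It)).
split=> [eta_geodesic t X W U It sec|eqs t It].
  by have [_ _ e0] := eta_geodesic t It; exact: (eqsP t X W U It sec).2 e0.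
have cov0 r : I r -> velocity (f \o b) r != 0 ->
    cov_param gQ (f (b r)) (f \o b : R^o -> Q) (velocity (f \o b)) r 1 = 0.
  move=> Ir v0; have [X [W [U sec]]] := velocity_sections_exist gP_metric hQ
    f_riemannian (range_D (b r)) (hb r Ir) v0.
  by apply/(eqsP r X W U Ir sec); exact: eqs.
have [cb sb _] := b_geodesic t It.
have [cfb sfb _] := velocity_map f_riemannian.1 cb sb.
split=> //; have [v0|] := eqVneq (velocity (f \o b) t) 0; last exact: cov0.
pose speed r := inner (gQ ((f \o b) r)) (velocity (f \o b) r) (velocity (f \o b) r).
have speed0 : \forall r \near t, speed r = speed t.
  apply: near_derive0_cst; apply: filterS (near_I t It) => r Ir.
  have hfb : \forall s \near r, {for s, continuous (f \o b)} /\
      smooth_near (s : R^o) (chart ((f \o b) s) \o (f \o b) : R^o -> 'rV[R]_n).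
    apply: filterS (hb r Ir) => s [cs ss].
    by have [] := velocity_map f_riemannian.1 cs ss.
  apply: is_derive_eq (derive_speed hQ hfb) _.
  (* Where the velocity vanishes, it kills the inner product as its second argument; elsewhere the
     covariant derivative is 0 by [cov0]. *)
  have [->|vr] := eqVneq (velocity (f \o b) r) 0; first by rewrite inner0r mulr0.
  by rewrite cov0 // inner0l mulr0.
(* Zero velocity at t alone would say nothing about its derivative; constant speed spreads the zero
   to a neighbourhood. *)
apply: cov_param_near0; apply: filterS speed0 => r.
rewrite /speed v0 inner0l => sr.
apply/eqP/negPn/negP => /((hQ (f (b r))).1.2).
by rewrite -/(f \o b) [inner _ _ _]sr ltxx.
Qed.
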